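(* Let $\mu$ be a probability measure on $\mathbb R$, absolutely continuous with respect to Lebesgue's measure, and for $n\ge1$ let $\mu^n$ be the $n$-fold product measure on $\mathbb R^n$. Let $H:\mathbb R\to\mathbb R^+$ be an even convex function with $H(0)=0$. Assume that $x\mapsto H(x)/x^2$ is non-decreasing for $x>0$ and that $H^*$ is strictly convex. If there exists $\kappa\in(0,+\infty)$ such that every locally Lipschitz $f:\mathbb R\to\mathbb R$ satisfies $$\mathbf{Ent}_\mu(f^2)\le\kappa\int H\left(\frac{f'}{f}\right)f^2\,d\mu,$$ then every Borel set $A\subset\mathbb R^n$ with $\mu^n(A)\ge\frac12$ satisfies $$1-\mu^n\left(A+\Big\{x:\sum_{i=1}^nH^*(x_i)<r\Big\}\right)\le e^{-Kr}\qquad\forall r\ge0,$$ where $K=\omega_H(2)\,\kappa\,\omega_H^*\left(\frac{1}{\omega_H(2)\,\kappa}\right)$.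
   Context: $H^*(y)=\sup_{x\ge0}\{x|y|-H(x)\}$. For $x\ge0$, $\omega_H(x)=\sup_{t>0}\frac{H(tx)}{H(t)}$ (with $0/0=0$ and $c/0=+\infty$ for $c>0$), and $\omega_H^*(y)=\sup_{x\ge0}\{xy-\omega_H(x)\}$ for $y\ge0$. If $\omega_H(2)=+\infty$, $K$ is read as $0$. $\mathbf{Ent}_\mu(g)=\int g\log g\,d\mu-(\int g\,d\mu)\log(\int g\,d\mu)$. For a locally Lipschitz $f$, $|f'|(x)=\lim_{r\to0^+}\sup_{|x-y|\le r}\frac{|f(x)-f(y)|}{|x-y|}$, equal almost everywhere to the absolute value of the usual derivative; only $|f'|$ matters since $H$ is even. The integrand $H(f'/f)f^2$ is read as $0$ at points where $f=0$ (where $f'=0$ almost everywhere). $A+B=\{a+b:a\in A,b\in B\}$. *)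

(* Defs.v *)
From HB Require Import structures.
From mathcomp Require Import all_boot all_order all_algebra.
From mathcomp Require Import all_classical all_reals all_analysis.

Set Implicit Arguments.
Unset Strict Implicit.
Unset Printing Implicit Defensive.

Import Order.TTheory GRing.Theory Num.Theory numFieldNormedType.Exports.

Local Open Scope classical_set_scope.
Local Open Scope ring_scope.

Section product_probability.
Context d (T : measurableType d) (R : realType) (mu : probability T R).

Definition cons_pair n (p : T * n.-tuple T) : n.+1.-tuple T :=
  [tuple of p.1 :: p.2].

Lemma measurable_cons_pair n : measurable_fun setT (@cons_pair n).
Proof.
exact: (measurable_cons (f := fst) (g := snd) measurable_fst measurable_snd).
Qed.

HB.instance Definition _ n :=
  @isMeasurableFun.Build _ _ _ _ (@cons_pair n) (@measurable_cons_pair n).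

(* mu^(n+1) is the image of mu \x mu^n under (x, t) |-> x :: t; power_prob_box
   below is the characterization on boxes. *)
Fixpoint power_prob n : probability (n.-tuple T) R :=
  match n with
  | 0 => \d_([tuple] : 0.-tuple T)
  | m.+1 => distribution (mu \x power_prob m)%E (@cons_pair m)
  end.

Lemma power_prob_box n (A : 'I_n -> set T) :
  (forall i, measurable (A i)) ->
  power_prob n [set x | forall i, A i (tnth x i)] = (\prod_(i < n) mu (A i))%E.
Proof.
elim: n A => [|n IH] A mA /=.
  by rewrite big_ord0 diracE (_ : _ \in _)// inE => -[].
rewrite big_ord_recl -IH; last by move=> i; exact: mA.
rewrite /distribution /pushforward -product_measure1E//.
- congr (_ _); apply/seteqP; split=> [[x t]|[x t] [/= Ax At] i].
    move=> /= H; split=> [|i]; first by have := H ord0; rewrite tnth0.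
    by have := H (lift ord0 i); rewrite tnthS.
  by case: (unliftP ord0 i) => [j ->|->]; rewrite ?tnth0 ?tnthS.
- rewrite (_ : [set _ | _] =
    \big[setI/setT]_(i < n) ((fun x => tnth x i) @^-1` A (lift ord0 i))).
    apply: bigsetI_measurable => i _; rewrite -[X in measurable X]setTI.
    by apply: measurable_tnth.
  rewrite -bigcap_seq; apply/seteqP; split=> x /= H i => [_|]; first exact: H.
  by apply: H; rewrite /= mem_index_enum.
Qed.

End product_probability.

Section defs.
Context {R : realType}.
Implicit Types (H f : R -> R) (x y : R).

Definition conjugate H y : \bar R :=
  ereal_sup [set (x * `|y| - H x)%:E | x in [set x | 0 <= x]].

(* Inversion in \bar R satisfies 0^-1 = +oo and 0 * +oo = 0, so the quotient
   obeys 0 / 0 = 0 and c / 0 = +oo for c > 0. *)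
Definition omega H x : \bar R :=
  ereal_sup [set ((H (t * x)%R)%:E / (H t)%:E)%E | t in [set t | 0 < t]].

Definition omega_conjugate H y : \bar R :=
  ereal_sup [set ((x * y)%:E - omega H x)%E | x in [set x | 0 <= x]].

Definition rate H (kappa : R) : \bar R :=
  (let w := omega H 2 in
   if w == +oo then 0
   else w * kappa%:E * omega_conjugate H (fine w * kappa)^-1%R)%E.

(* Strict convexity on the effective domain. *)
Definition strictly_convex (g : R -> \bar R) :=
  forall x y (t : R), x != y -> 0 < t < 1 -> (g x < +oo)%E -> (g y < +oo)%E ->
    (g (t * x + (1 - t) * y)%R < t%:E * g x + (1 - t)%:E * g y)%E.

(* lne 0 = -oo and 0 * -oo = 0, while ln 0 = 0: both terms use 0 log 0 = 0. *)
Definition Ent (mu : probability (measurableTypeR R) R) (g : R -> R) : \bar R :=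
  (\int[mu]_x (g x * ln (g x))%:E
   - (\int[mu]_x (g x)%:E) * lne (\int[mu]_x (g x)%:E))%E.

Definition metric_slope f x : \bar R :=
  lim (ereal_sup [set (`|f x - f y| / `|x - y|)%:E
        | y in [set y | `|x - y| <= r /\ y != x]] @[r --> 0^'+]).

(* Where f x = 0 the integrand is 0, because of the factor f x ^+ 2. *)
Definition energy (mu : probability (measurableTypeR R) R) H f : \bar R :=
  (\int[mu]_x (H (fine (metric_slope f x) / f x)%R * f x ^+ 2)%:E)%E.

(* Functions outside L^2(mu) are excluded: their entropy is not defined. *)
Definition modified_log_Sobolev (mu : probability (measurableTypeR R) R) H
    (kappa : R) :=
  forall f, [locally [lipschitz f x | x in setT]] ->
    mu.-integrable setT (fun x => (f x ^+ 2)%:E) ->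
    (Ent mu (fun x => f x ^+ 2)%R <= kappa%:E * energy mu H f)%E.

Definition Minkowski_sum n (A B : set (n.-tuple (measurableTypeR R))) :
    set (n.-tuple (measurableTypeR R)) :=
  [set [tuple (tnth a i + tnth b i : R) | i < n] | a in A & b in B].

Definition conjugate_ball H n (r : R) : set (n.-tuple (measurableTypeR R)) :=
  [set x | (\sum_(i < n) conjugate H (tnth x i) < r%:E)%E].

End defs.

(* Main.v *)
Require Import Defs.
From HB Require Import structures.
From mathcomp Require Import all_boot all_order all_algebra.
From mathcomp Require Import all_classical all_reals all_analysis.
From mathcomp Require Import measurable_realfun ring lra.
Import Order.TTheory GRing.Theory Num.Theory numFieldNormedType.Exports.
Local Open Scope classical_set_scope.
Local Open Scope ring_scope.

(* Let [Q_t f x] be the infimum over [u] of [f (x - t u) + t H^*(u)]. For [f]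
   Lipschitz and semiconcave, [Q_t f] is semiconcave too, which yields the
   Hamilton-Jacobi inequality [H (|(Q_t f)'| / 2) <= - d/dt Q_t f] at every
   point, without Rademacher's theorem. Applied to [exp (alpha t Q_t f / 2)],
   the log-Sobolev inequality then shows that
   [ln (int exp (alpha t Q_t f)) / t] is nonincreasing in [t]; hence
   [int exp (2 x Q_1 f) <= exp (2 x int f)] as soon as
   [omega_H(2) kappa omega_H(x) < x]. This inequality tensorizes. For a
   semiconcave approximation [f] of [r 1_(A^c)], the infimum-convolution is
   almost [r] outside [A + {sum H^* < r}] while [int f <= r / 2], so the
   complement has measure at most [exp (- x r)]; the rate [K] is the supremum
   of [x - omega_H(2) kappa omega_H(x)], hence at most the supremum of the
   admissible [x]. *)

Set Implicit Arguments.
Unset Strict Implicit.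
Unset Printing Implicit Defensive.

(** * Infima and semiconcavity *)

(** The Hopf-Lax formula bounds [Q_(t+h) f] at [x] only from above, by values of [Q_t f] at
    [x - h u] and [x + h u]. It limits how far [Q_t f] descends from [x], whereas the metric slope
    is two-sided. Semiconcavity closes the gap: a steep ascent on one side forces a steep descent on
    the other. The [1/2] inside [H] comes from using a chord slope of [H] in place of biconjugation,
    and the factor [omega_H(2)] undoes it. The exponent is [2 x] because half of the gain [2 x r] is
    spent on the mean of [f], which may be as large as [r / 2]. Nothing is differentiated under the
    integral sign. The error in the Hamilton-Jacobi inequality is not uniform in the point, so
    Fatou's lemma provides only some arbitrarily small good time steps from each [t], and the
    monotonicity argument is built to accept just these. *)

Section infimum.
Context {R : realType} {I : Type}.
Implicit Types F : I -> R.

Lemma infr_le F m i : (forall i, m <= F i) -> inf (range F) <= F i.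
Proof.
by move=> mF; apply: ge_inf; [exists m => _ [j _ <-]|exists i].
Qed.

Lemma le_infr F m (i0 : I) : (forall i, m <= F i) -> m <= inf (range F).
Proof.
by move=> mF; apply: lb_le_inf; [exists (F i0), i0|move=> _ [j _ <-]].
Qed.

End infimum.

Section infimum_inequalities.
Context {R : realType} {I J K : Type}.
Implicit Types (F : I -> R) (G : J -> R).

Lemma infr_leD F G (m d : R) (j0 : J) : (forall i, m <= F i) ->
  (forall j, exists i, F i <= G j + d) -> inf (range F) <= inf (range G) + d.
Proof.
move=> mF FG; rewrite -lerBlDr; apply: (le_infr j0) => j.
have [i Fi] := FG j; rewrite lerBlDr; apply: le_trans Fi.
exact: infr_le mF.
Qed.

Lemma infr_conv F G (k : K -> R) (m d t : R) (k0 : K) : 0 <= t <= 1 ->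
  (forall i, m <= F i) -> (forall j, m <= G j) ->
  (forall l, exists i j, t * F i + (1 - t) * G j <= k l + d) ->
  t * inf (range F) + (1 - t) * inf (range G) <= inf (range k) + d.
Proof.
move=> /andP[t0 t1] mF mG FG; rewrite -lerBlDr; apply: (le_infr k0) => l.
have [i [j Fi]] := FG l; rewrite lerBlDr; apply: le_trans Fi.
by rewrite lerD// ler_wpM2l ?subr_ge0//; [exact: infr_le mF|exact: infr_le mG].
Qed.

End infimum_inequalities.

Section semiconcave.
Context {R : realType}.
Implicit Types (f v c : R -> R).

Definition lip (L : R) f := forall x y, `|f x - f y| <= L * `|x - y|.

(** Equivalent to concavity of [f y - C * y ^+ 2]: the mean of the squares exceeds the square of the
    mean by exactly [t * (1 - t) * (x - y) ^+ 2]. *)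
Definition semiconcave (C : R) f := forall x y t, 0 <= t <= 1 ->
  t * f x + (1 - t) * f y
    <= f (t * x + (1 - t) * y) + C * (t * (1 - t) * (x - y) ^+ 2).

(** Descents from [x] at the single distance [z] control every increment up to [z]. The lower bound
    uses the chord from [x] to [x + z]. For the upper bound, [x] lies between [x - z] and [x + w],
    so a steep ascent to [x + w] would force a steep descent to [x - z]. *)
Lemma semiconcave_dir C f x w z q : 0 <= C -> semiconcave C f ->
  0 < w -> w <= z -> 0 <= q ->
  f x - f (x - z) <= q * z -> f x - f (x + z) <= q * z ->
  `|f (x + w) - f x| <= (q + 2 * C * z) * w.
Proof.
move=> C0 Cf w0 wz q0 fm fp.
have z0 : 0 < z by exact: lt_le_trans wz.
rewrite ler_norml; apply/andP; split.
- have t01 : 0 <= w / z <= 1 by rewrite ler_pdivrMr// mul1r wz divr_ge0// ltW.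
  have := Cf (x + z) x _ t01.
  have -> : w / z * (x + z) + (1 - w / z) * x = x + w by field; rewrite gt_eqF.
  have -> : x + z - x = z by ring.
  set t := w / z in t01 *; have wE : w = t * z by rewrite /t; field; rewrite gt_eqF.
  move: t01 => /andP[t0 t1] H.
  have h1 : t * (f x - f (x + z)) <= t * (q * z) by rewrite ler_wpM2l.
  have h2 : C * (t * (1 - t) * z ^+ 2) <= C * (2 * (t * z ^+ 2)).
    have p0 : 0 <= t * z ^+ 2 by rewrite mulr_ge0// sqr_ge0.
    have tp0 : 0 <= t * (t * z ^+ 2) by rewrite mulr_ge0.
    by rewrite ler_wpM2l//; lra.
  rewrite [X in - (_ * X)]wE; clearbody t; clear wE; lra.
- have zw0 : 0 < z + w by exact: addr_gt0.
  have t01 : 0 <= w / (z + w) <= 1.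
    by rewrite ler_pdivrMr// mul1r lerDr (ltW z0) divr_ge0// ltW.
  have := Cf (x - z) (x + w) _ t01.
  have -> : w / (z + w) * (x - z) + (1 - w / (z + w)) * (x + w) = x.
    by field; rewrite gt_eqF.
  have -> : x - z - (x + w) = - (z + w) by ring.
  rewrite sqrrN.
  have -> : 1 - w / (z + w) = z / (z + w) by field; rewrite gt_eqF.
  have -> : w / (z + w) * (z / (z + w)) * (z + w) ^+ 2 = w * z.
    by field; rewrite gt_eqF.
  rewrite ![_ / _ * f _]mulrAC -mulrDl ler_pdivrMr// => H.
  have h1 : w * (f x - f (x - z)) <= w * (q * z) by rewrite ler_wpM2l// ltW.
  have h2 : C * (w * z) * (z + w) <= C * (w * z) * (2 * z).
    rewrite ler_wpM2l//; last lra.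
    by rewrite !mulr_ge0// ltW.
  rewrite -(ler_pM2l z0).
  lra.
Qed.

Lemma semiconcave_lip_at C f x z q : 0 <= C -> semiconcave C f ->
  0 < z -> 0 <= q ->
  f x - f (x - z) <= q * z -> f x - f (x + z) <= q * z ->
  forall y, `|x - y| <= z -> `|f x - f y| <= (q + 2 * C * z) * `|x - y|.
Proof.
move=> C0 Cf z0 q0 fm fp y; have [->|xNy] := eqVneq x y.
  by rewrite !subrr normr0 mulr0.
have [yx|yx] := ltP x y.
  rewrite (distrC (f x)) (distrC x) gtr0_norm ?subr_gt0// => yz.
  rewrite (_ : f y = f (x + (y - x))); last by congr f; ring.
  by apply: (@semiconcave_dir C) => //; rewrite subr_gt0.
have xy : y < x by rewrite lt_neqAle eq_sym xNy.
rewrite (distrC (f x)) gtr0_norm ?subr_gt0// => yz.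
(* Points to the left of [x] reduce to the previous case by reflection, which exchanges the two
   descent hypotheses. *)
have Cg : semiconcave C (fun u => f (- u)).
  move=> a b t t01; have := Cf (- a) (- b) t t01.
  rewrite (_ : t * - a + (1 - t) * - b = - (t * a + (1 - t) * b)); last ring.
  by rewrite (_ : - a - - b = - (a - b)) ?sqrrN//; ring.
have := @semiconcave_dir C (fun u => f (- u)) (- x) (x - y) z q C0 Cg.
rewrite (_ : - (- x - z) = x + z); last ring.
rewrite (_ : - (- x + z) = x - z); last ring.
rewrite (_ : - (- x + (x - y)) = y); last ring.
by rewrite opprK subr_gt0; apply.
Qed.

End semiconcave.

(** * Metric slopes *)

Section exponential_bounds.
Context {R : realType}.
Implicit Types y d : R.

(** Inverting [expR (- y) >= 1 - y] gives [expR y <= (1 - y)^-1], and the quadratic times [1 - y] is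
    at least 1 up to [y = 1/2]. *)
Lemma expR_le_quadratic y : y <= 2^-1 -> expR y <= 1 + y + 2 * y ^+ 2.
Proof.
move=> y2; have := expR_ge1Dx (- y); rewrite expRN => H.
have E0 := expR_gt0 y.
have h1 : (1 - y) * expR y <= 1.
  by rewrite -[leRHS](mulVf (lt0r_neq0 E0)) ler_wpM2r// ltW.
have h2 : 1 <= (1 - y) * (1 + y + 2 * y ^+ 2).
  have -> : (1 - y) * (1 + y + 2 * y ^+ 2) = 1 + y ^+ 2 * (1 - 2 * y) by ring.
  by rewrite lerDl mulr_ge0 ?sqr_ge0//; lra.
by rewrite -(@ler_pM2l _ (1 - y)) ?(le_trans h1)//; lra.
Qed.

Lemma norm_expRB1_le d : `|d| <= 2^-1 -> `|expR d - 1| <= `|d| + 2 * d ^+ 2.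
Proof.
rewrite ler_norml => /andP[d1 d2].
have := expR_le_quadratic d2; have := expR_ge1Dx d; have := sqr_ge0 d.
by rewrite ler_norml; case: (ler0P d) => *; apply/andP; split; lra.
Qed.

End exponential_bounds.

Section metric_slope_bounds.
Context {R : realType}.
Implicit Types f v : R -> R.

Lemma metric_slope_cvg f x :
  cvg (ereal_sup [set (`|f x - f y| / `|x - y|)%:E
        | y in [set y | `|x - y| <= r /\ y != x]] @[r --> 0^'+]).
Proof.
apply: nondecreasing_at_right_is_cvge; near=> z => a b _ _ ab.
apply: ereal_sup_le => _ [y [/= xy yx] <-]; exists y => //=.
by split=> //; exact: le_trans ab.
Unshelve. all: by end_near. Qed.

Lemma metric_slope_ge0 f x : (0 <= metric_slope f x)%E.
Proof.
apply: lime_ge; first exact: metric_slope_cvg.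
near=> r.
have r0 : 0 < r by near: r; exact: nbhs_right_gt.
apply: (@le_trans _ _ (`|f x - f (x + r)| / `|x - (x + r)|)%:E).
  by rewrite lee_fin divr_ge0.
apply: ereal_sup_ubound; exists (x + r) => //=; split.
  by rewrite (_ : x - (x + r) = - r) ?normrN ?gtr0_norm//; ring.
by rewrite -subr_eq0 addrAC subrr add0r gt_eqF.
Unshelve. all: by end_near. Qed.

Lemma metric_slope_le f x z b : 0 < z ->
  (forall y, `|x - y| <= z -> `|f x - f y| <= b * `|x - y|) ->
  (metric_slope f x <= b%:E)%E.
Proof.
move=> z0 H; apply: lime_le; first exact: metric_slope_cvg.
near=> r; apply: ge_ereal_sup => _ [y [/= xy yx] <-].
rewrite lee_fin ler_pdivrMr; last by rewrite normr_gt0 subr_eq0 eq_sym.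
by apply: H; apply: (le_trans xy); near: r; exact: nbhs_right_le.
Unshelve. all: by end_near. Qed.

(** [s] plays the role of the slope of [v], read off from its exponential [F], the function fed to
    the log-Sobolev inequality. In [B], [2 * C] is the semiconcavity error and [lambda * L ^+ 2] the
    second-order error of the exponential; [z0] keeps the increments of the exponent below 1/2. *)
Lemma slope_expR_le L C v (lambda : R) x : 0 <= L -> 0 <= C -> 0 < lambda ->
  lip L v -> semiconcave C v ->
  let F y := expR (lambda / 2 * v y) in
  let s := 2 / lambda * (fine (metric_slope F x) / F x) in
  0 <= s /\ exists B z0, [/\ 0 <= B, 0 < z0 &
  forall z q, 0 < z -> z <= z0 -> 0 <= q ->
    v x - v (x - z) <= q -> v x - v (x + z) <= q -> s * z <= q + B * z ^+ 2].
Proof.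
move=> L0 C0 l0 Lv Cv F s.
have F0 y : 0 < F y by exact: expR_gt0.
split.
  have m0 : 0 <= fine (metric_slope F x) by apply/fine_ge0/metric_slope_ge0.
  by rewrite /s mulr_ge0// divr_ge0// ltW.
exists (2 * C + lambda * L ^+ 2), (1 / (lambda * L + 1)).
have lL : 0 <= lambda * L by rewrite mulr_ge0// ltW.
split; [|by rewrite divr_gt0//; lra|].
  by rewrite addr_ge0// mulr_ge0// ?sqr_ge0// ltW.
move=> z q z0; rewrite ler_pdivlMr; last lra.
move=> zz0 q0 vm vp.
have zL : lambda * L * z <= 1 by nra.
set p := q / z + 2 * C * z.
have qz0 : 0 <= q / z by rewrite divr_ge0// ltW.
have p0 : 0 <= p by rewrite addr_ge0// !mulr_ge0// ltW.
have l2 : 0 <= lambda / 2 by rewrite divr_ge0// ltW.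
have lp0 : 0 <= lambda / 2 * p by exact: mulr_ge0.
have lL2 : 0 <= lambda ^+ 2 / 2 * L ^+ 2.
  by apply: mulr_ge0; [apply: divr_ge0 => //|]; exact: sqr_ge0.
have lL0 : 0 <= lambda ^+ 2 / 2 * L ^+ 2 * z by rewrite mulr_ge0// ltW.
have vxy : forall y, `|x - y| <= z -> `|v x - v y| <= p * `|x - y|.
  by apply: semiconcave_lip_at => //; rewrite divfK ?gt_eqF.
suff : (metric_slope F x <= (F x * (lambda / 2 * p + lambda ^+ 2 / 2 * L ^+ 2 * z))%:E)%E.
  (* [fine] sends an infinite value to 0, which satisfies the bound because its right-hand side is
     nonnegative. *)
  have fs : (metric_slope F x \is a fin_num) \/ fine (metric_slope F x) = 0.
    by case: metric_slope => [r||]; [left|right|right].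
  have E0 : 0 <= F x * (lambda / 2 * p + lambda ^+ 2 / 2 * L ^+ 2 * z).
    by apply: mulr_ge0; [exact: ltW|exact: addr_ge0].
  move=> H; have {H fs E0} H : fine (metric_slope F x) <=
      F x * (lambda / 2 * p + lambda ^+ 2 / 2 * L ^+ 2 * z).
    by case: fs => [/fineK fE|->//]; rewrite -lee_fin fE.
  have : fine (metric_slope F x) / F x <= lambda / 2 * p + lambda ^+ 2 / 2 * L ^+ 2 * z.
    by rewrite ler_pdivrMr// mulrC.
  move=> {}H; rewrite /s.
  have : 2 / lambda * (fine (metric_slope F x) / F x) <=
     2 / lambda * (lambda / 2 * p + lambda ^+ 2 / 2 * L ^+ 2 * z).
    by rewrite ler_wpM2l// divr_ge0// ltW.
  have -> : 2 / lambda * (lambda / 2 * p + lambda ^+ 2 / 2 * L ^+ 2 * z) =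
     p + lambda * L ^+ 2 * z by field; rewrite gt_eqF.
  rewrite -(ler_pM2r z0) => /le_trans; apply.
  by rewrite /p !mulrDl divfK ?gt_eqF// le_eqVlt; apply/orP; left; apply/eqP; ring.
apply: (metric_slope_le z0) => y xy.
have -> : F x - F y = F x * (1 - expR (lambda / 2 * (v y - v x))).
  by rewrite mulrBr mulr1 -expRD; congr (_ - expR _); ring.
rewrite normrM (gtr0_norm (F0 x)) -[leRHS]mulrA ler_wpM2l ?(ltW (F0 x))// distrC.
set d := lambda / 2 * _.
have dE : `|d| = lambda / 2 * `|v x - v y|.
  by rewrite /d normrM (distrC (v y)) gtr0_norm// divr_gt0.
have hn := normr_ge0 (x - y).
have d1 : `|d| <= lambda / 2 * (L * `|x - y|).
  by rewrite dE ler_wpM2l ?Lv.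
have d2 : `|d| <= lambda / 2 * (p * `|x - y|).
  by rewrite dE ler_wpM2l ?vxy.
have d3 : lambda / 2 * (L * `|x - y|) <= 2^-1.
  have : lambda * L * `|x - y| <= lambda * L * z by rewrite ler_wpM2l.
  by lra.
apply: (le_trans (norm_expRB1_le (le_trans d1 d3))).
rewrite [leRHS]mulrDl lerD//; first by rewrite mulrA in d2.
have h : `|d| ^+ 2 <= (lambda / 2 * (L * `|x - y|)) ^+ 2.
  by rewrite ler_sqr ?nnegrE// (le_trans _ d1).
have h2 : `|x - y| ^+ 2 <= z * `|x - y| by rewrite expr2 ler_wpM2r.
have h3 : (lambda ^+ 2 / 2 * L ^+ 2) * `|x - y| ^+ 2 <= (lambda ^+ 2 / 2 * L ^+ 2) * (z * `|x - y|).
  by rewrite ler_wpM2l.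
by rewrite -[d ^+ 2]real_normK ?num_real//; lra.
Qed.

End metric_slope_bounds.

(** * The Hopf-Lax semigroup and the Herbst argument *)

Section hopf_lax.
Context {R : realType} (c f : R -> R) (r L C : R).
Context (c0 : c 0 = 0) (c_ge0 : forall u, 0 <= c u)
  (c_conv : forall a b t, 0 <= t <= 1 ->
    c (t * a + (1 - t) * b) <= t * c a + (1 - t) * c b)
  (f_ge0 : forall x, 0 <= f x) (f_le : forall x, f x <= r)
  (f_lip : lip L f) (f_sc : semiconcave C f).

(** Parametrized by the velocity [u] instead of the end point: no division by [t] occurs, and
    [t = 0] gives back [f]. *)
Definition hopf_lax t x := inf (range (fun u => f (x - t * u) + t * c u)).

Let bound0 t x u : 0 <= t -> 0 <= f (x - t * u) + t * c u.
Proof. by move=> t0; rewrite addr_ge0// mulr_ge0. Qed.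

Lemma hopf_lax_le t x u : 0 <= t -> hopf_lax t x <= f (x - t * u) + t * c u.
Proof.
move=> t0; apply: (infr_le (F := fun u => f (x - t * u) + t * c u) (m := 0)) => w.
exact: bound0.
Qed.

Lemma hopf_lax_ge0 t x : 0 <= t -> 0 <= hopf_lax t x.
Proof. by move=> t0; apply: (le_infr 0) => u; exact: bound0. Qed.

Lemma hopf_lax_le0 t x : 0 <= t -> hopf_lax t x <= f x.
Proof. by move=> /(hopf_lax_le x 0); rewrite c0 !mulr0 subr0 addr0. Qed.

Lemma hopf_lax_le_bound t x : 0 <= t -> hopf_lax t x <= r.
Proof. by move=> t0; exact: le_trans (hopf_lax_le0 _ t0) _. Qed.

Lemma hopf_lax_lip t : 0 <= t -> lip L (hopf_lax t).
Proof.
move=> t0.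
have H x y : hopf_lax t x <= hopf_lax t y + L * `|x - y|.
  apply: (infr_leD 0 (m := 0)) => [u|u]; first exact: bound0.
  exists u; rewrite addrAC lerD2r -lerBlDl (le_trans (ler_norm _))//.
  by apply: le_trans (f_lip _ _) _; rewrite opprB addrA subrK.
move=> x y; rewrite ler_norml lerBlDl H andbT lerBrDl -lerBrDr opprK.
by rewrite distrC; exact: H.
Qed.

Lemma hopf_lax_semiconcave t : 0 <= t -> semiconcave C (hopf_lax t).
Proof.
move=> t0 x y s s01.
apply: (infr_conv 0 (m := 0)) => // [u|u|u]; [exact: bound0|exact: bound0|].
exists u, u.
have := f_sc (x - t * u) (y - t * u) s01.
rewrite (_ : s * (x - t * u) + (1 - s) * (y - t * u) = s * x + (1 - s) * y - t * u); last ring.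
by rewrite (_ : x - t * u - (y - t * u) = x - y); [lra|ring].
Qed.

(** One inequality of the semigroup law: velocity [u] for time [h], then [w] for time [t], covers
    the same distance as the mean velocity for time [t + h], which costs no more by convexity of
    [c]. *)
Lemma hopf_lax_step t h x u : 0 <= t -> 0 <= h -> 0 < t + h ->
  hopf_lax (t + h) x <= hopf_lax t (x - h * u) + h * c u.
Proof.
move=> t0 h0 th; apply: (infr_leD 0 (m := 0)) => [w|w].
  by apply: bound0; exact: addr_ge0.
have [s [s01 tE hE]] : exists s,
    [/\ 0 <= s <= 1, (t + h) * s = t & (t + h) * (1 - s) = h].
  exists (t / (t + h)); split; try by field; rewrite gt_eqF.
    by rewrite ler_pdivrMr// mul1r lerDl h0 andbT divr_ge0// ltW.
exists (s * w + (1 - s) * u).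
rewrite -addrA lerD//.
  rewrite le_eqVlt; apply/orP; left; apply/eqP; congr f.
  by rewrite mulrDr !mulrA tE hE; ring.
apply: (@le_trans _ _ ((t + h) * (s * c w + (1 - s) * c u))).
  by rewrite ler_wpM2l ?c_conv// ltW.
by rewrite mulrDr !mulrA tE hE.
Qed.

Lemma hopf_lax_nonincreasing s t x : 0 <= s -> s <= t ->
  hopf_lax t x <= hopf_lax s x.
Proof.
move=> s0; rewrite le_eqVlt => /predU1P[->//|st].
have := @hopf_lax_step s (t - s) x 0 s0.
rewrite subrKC c0 !mulr0 subr0 addr0; apply; first by rewrite subr_ge0 ltW.
exact: le_lt_trans st.
Qed.

(** Competing at both times with the same velocity [u] moves the end point by [(t - s) * u] and
    saves the cost [(t - s) * c u]. In the application [B] is [H L]. *)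
Lemma hopf_lax_decr B s t x : (forall u, L * `|u| - c u <= B) ->
  0 <= s -> s <= t -> hopf_lax s x <= hopf_lax t x + (t - s) * B.
Proof.
move=> LB s0 st; apply: (infr_leD 0 (m := 0)) => [u|u]; first exact: bound0.
exists u.
have := f_lip (x - s * u) (x - t * u).
rewrite (_ : x - s * u - (x - t * u) = (t - s) * u); last ring.
rewrite normrM (ger0_norm (_ : 0 <= t - s)) ?subr_ge0//.
move=> /(le_trans (ler_norm _)) H.
have : (t - s) * (L * `|u| - c u) <= (t - s) * B.
  by rewrite ler_wpM2l// subr_ge0.
lra.
Qed.

End hopf_lax.

Section growth.
Context {R : realType}.

(* Only one step [h], of any size, is required from each point: completeness
   of the reals turns these steps into a path from [a] to [b]. *)
Lemma growth_le (Phi : R -> R) a b K : a <= b -> 0 <= K ->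
  (forall s t, a <= s -> s <= t -> t <= b -> Phi t <= Phi s + K * (t - s)) ->
  (forall t eps, a <= t -> t < b -> 0 < eps ->
    exists h, [/\ 0 < h, t + h <= b & Phi (t + h) <= Phi t + eps * h]) ->
  Phi b <= Phi a.
Proof.
move=> ab K0 PhiK Phistep; apply/ler_addgt0Pr => e e0.
pose eps := e / (b - a + 1).
have ba1 : 0 < b - a + 1 by lra.
have eps0 : 0 < eps by rewrite divr_gt0.
pose S := [set t | a <= t <= b /\ Phi t <= Phi a + eps * (t - a)].
have Sa : S a by rewrite /S/= lexx ab subrr mulr0 addr0.
have Sub : ubound S b by move=> t [/andP[]].
have hS : has_sup S by split; [exists a|exists b].
set tau := sup S.
have atau : a <= tau by exact: sup_upper_bound.
have taub : tau <= b by apply: ge_sup => //; exists a.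
(* The bound with [K] excludes upward jumps, so the supremum belongs to [S]; were it below [b], one
   more step would exceed it. *)
have Stau : S tau.
  split; first by rewrite atau taub.
  apply/ler_addgt0Pr => d d0.
  have Kd : 0 < d / (K + 1) by rewrite divr_gt0//; lra.
  have [t [/andP[at_ tb] St] tt] := sup_adherent Kd hS.
  have ttau : t <= tau by apply: sup_upper_bound => //; split=> //; apply/andP.
  have := PhiK _ _ at_ ttau taub.
  have : K * (tau - t) <= d.
    have : (K + 1) * (tau - t) <= d.
      by rewrite mulrC -ler_pdivlMr; [rewrite -/tau in tt; lra|lra].
    by rewrite mulrDl mul1r; lra.
  have : eps * (t - a) <= eps * (tau - a) by rewrite ler_wpM2l; lra.
  lra.
have [tb|btau] := ltP tau b; last first.
  have -> : b = tau by apply/eqP; rewrite eq_le taub btau.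
  apply: (le_trans Stau.2); rewrite lerD2l.
  by rewrite /eps mulrAC ler_pdivrMr// ler_wpM2l; lra.
have [h [h0 thb Ph]] := Phistep tau eps atau tb eps0.
have : tau + h <= tau.
  apply: sup_upper_bound => //; split; first by rewrite thb andbT; lra.
  by move: Stau => [_]; lra.
by rewrite gerDl leNgt h0.
Qed.

Lemma ln_le_tangent (a b : R) : 0 < a -> 0 < b -> ln b <= ln a + (b - a) / a.
Proof.
move=> a0 b0; have ab : b = a * (1 + (b - a) / a) by field; rewrite gt_eqF.
have p0 : 0 < 1 + (b - a) / a by rewrite -(pmulr_rgt0 _ a0) -ab.
by rewrite {1}ab lnM ?posrE// lerD2l le_ln1Dx//; lra.
Qed.

(* Herbst's argument: [t Z' <= Z ln Z] says that [ln Z / t] is nonincreasing. *)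
Lemma herbst (Z : R -> R) T b m D t1 : 0 < T -> 0 <= b -> 0 <= D -> 0 < t1 ->
  (forall t, 0 < t -> t <= T -> 1 <= Z t) ->
  (forall s t, 0 < s -> s <= t -> t <= T -> Z t <= expR (b * (t - s)) * Z s) ->
  (forall t, 0 < t -> t <= T -> t <= t1 -> Z t <= 1 + m * t + D * t ^+ 2) ->
  (forall t eps, 0 < t -> t < T -> 0 < eps -> exists h,
    [/\ 0 < h, t + h <= T & t * (Z (t + h) - Z t) <= h * (Z t * ln (Z t) + eps)]) ->
  Z T <= expR (m * T).
Proof.
move=> T0 b0 D0 t10 Z1 Zb Zstart Zstep.
have Z0 t : 0 < t -> t <= T -> 0 < Z t.
  by move=> t0 tT; apply: lt_le_trans (Z1 _ t0 tT).
have lnZ0 t : 0 < t -> t <= T -> 0 <= ln (Z t).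
  by move=> t0 tT; rewrite ln_ge0// Z1.
rewrite -[leLHS](lnK (_ : Z T \is Num.pos)) ?posrE ?Z0// ler_expR -ler_pdivrMr//.
apply/ler_addgt0Pr => e e0.
have D1 : 0 < D + 1 by exact: ltr_wpDl.
(* [ln Z / t] is singular at 0, so monotonicity is used only from a [t0] at which the quotient is at
   most [m + D * t0 <= m + e]. *)
pose t0 := Num.min T (Num.min t1 (e / (D + 1))).
have t00 : 0 < t0 by rewrite !lt_min T0 t10 divr_gt0.
have t0T : t0 <= T by rewrite ge_min lexx.
have t01 : t0 <= t1 by rewrite !ge_min lexx orbT.
have t02 : t0 * (D + 1) <= e by rewrite -ler_pdivlMr// !ge_min lexx !orbT.
apply: (@le_trans _ _ (ln (Z t0) / t0)); last first.
  rewrite ler_pdivrMr//.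
  apply: (le_trans (ln_le_tangent ltr01 (Z0 _ t00 t0T))).
  rewrite ln1 divr1 add0r; have := Zstart _ t00 t0T t01.
  have : t0 * (t0 * (D + 1)) <= t0 * e by rewrite ler_wpM2l// ltW.
  by have := sqr_ge0 t0; lra.
apply: (@growth_le (fun t => ln (Z t) / t) t0 T (b / t0)) => //.
- by rewrite divr_ge0// ltW.
- move=> s t t0s st tT.
  have s0 : 0 < s by exact: lt_le_trans t0s.
  have t'0 : 0 < t by exact: lt_le_trans st.
  have sT : s <= T by exact: le_trans tT.
  have lnZ : ln (Z t) <= ln (Z s) + b * (t - s).
    have P0 : 0 < expR (b * (t - s)) * Z s by rewrite mulr_gt0 ?expR_gt0 ?Z0.
    have : ln (Z t) <= ln (expR (b * (t - s)) * Z s).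
      by rewrite ler_ln ?posrE ?Z0// Zb.
    by rewrite lnM ?posrE ?expR_gt0 ?Z0// expRK addrC.
  rewrite ler_pdivrMr//; apply: (le_trans lnZ); rewrite mulrDl; apply: lerD.
    by rewrite mulrAC ler_pdivlMr// ler_wpM2l// lnZ0.
  rewrite (_ : b / t0 * (t - s) * t = b * (t - s) * (t / t0)); last ring.
  rewrite ler_peMr//; first by rewrite mulr_ge0// subr_ge0.
  by rewrite ler_pdivlMr// mul1r (le_trans t0s).
- move=> t eps t0t tT eps0.
  have t'0 : 0 < t by exact: lt_le_trans t0t.
  have tT' := ltW tT.
  (* The factor [t ^+ 2] compensates the division by [t ^+ 2] in the derivative of [ln Z / t]. *)
  have et0 : 0 < eps * t ^+ 2 by rewrite mulr_gt0// exprn_gt0.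
  have [h [h0 thT Zh]] := Zstep t _ t'0 tT et0.
  exists h; split => //.
  have th0 : 0 < t + h by exact: addr_gt0.
  have lnZ := ler_wpM2l (ltW t'0) (ln_le_tangent (Z0 _ t'0 tT') (Z0 _ th0 thT)).
  have Hln : t * ((Z (t + h) - Z t) / Z t) <= h * ln (Z t) + h * (eps * t ^+ 2).
    rewrite [t * (_ / _)]mulrA ler_pdivrMr ?Z0//; apply: (le_trans Zh).
    rewrite mulrDl mulrDr; apply: lerD; first by rewrite (mulrC (Z t)) mulrA.
    by rewrite ler_peMr ?Z1//; apply: mulr_ge0; exact: ltW.
  rewrite ler_pdivrMr// -(ler_pM2l t'0).
  have -> : t * ((ln (Z t) / t + eps * h) * (t + h)) =
     (t + h) * ln (Z t) + h * (eps * t ^+ 2) + eps * h * t * h.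
    by field; rewrite gt_eqF.
  have : 0 <= eps * h * t * h by rewrite !mulr_ge0// ltW.
  lra.
Qed.

End growth.

(** * Integrals of bounded functions *)

Section bounded_integrals.
Context d (T : measurableType d) {R : realType} (mu : probability T R).
Implicit Types f g : T -> R.

Lemma bounded_integrable f (M : R) : measurable_fun setT f ->
  (forall x, `|f x| <= M) -> mu.-integrable setT (EFin \o f).
Proof.
move=> mf fM; apply: measurable_bounded_integrable => //.
  by rewrite -ge0_fin_numE//; exact: fin_num_measure.
by exists M; split; [exact: num_real|move=> K MK x _ /=; exact: (le_trans (fM x) (ltW MK))].
Qed.

Lemma EFin_Rintegral f : mu.-integrable setT (EFin \o f) ->
  (\int[mu]_x f x)%:E = (\int[mu]_x (f x)%:E)%E.
Proof. by move=> fi; rewrite /Rintegral fineK//; exact: integrable_fin_num. Qed.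

Lemma Rintegral_prob_cst (r : R) : \int[mu]_x r = r.
Proof. by rewrite Rintegral_cst//= probability_setT mulr1. Qed.

(** The integral of a nonnegative function is a supremum over the simple functions below it, hence
    monotone even on functions not known to be measurable, such as the energy integrand with its
    metric slope. *)
Lemma ge0_le_integral_nomeas (f g : T -> \bar R) :
  (forall x, 0 <= f x)%E -> (forall x, f x <= g x)%E ->
  (\int[mu]_x f x <= \int[mu]_x g x)%E.
Proof.
move=> f0 fg; have g0 x : (0 <= g x)%E by exact: le_trans (fg x).
rewrite !ge0_integralTE//; apply: ereal_sup_le => _ [h /= hf <-].
by exists h => //= x; exact: le_trans (fg x).
Qed.

Lemma measurable_expRM f (a : R) : measurable_fun setT f ->
  measurable_fun setT (fun x => expR (a * f x)).
Proof.
move=> mf; apply: measurableT_comp; first exact: measurable_expR.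
exact: measurable_funM.
Qed.

End bounded_integrals.

Section liminf.
Context {R : realType}.
Implicit Types u : (\bar R)^nat.

Lemma le_limn_einf u (l : R) :
  (forall e : R, 0 < e -> exists N, forall n, (N <= n)%N -> ((l - e)%:E <= u n)%E) ->
  (l%:E <= limn_einf u)%E.
Proof.
move=> H; apply/lee_subgt0Pr => e e0; have [N HN] := H e e0.
rewrite limn_einf_lim (cvg_lim _ (@cvg_einfs_sup _ u))//.
apply: (@le_trans _ _ (einfs u N)).
  by apply: le_ereal_inf_tmp => _ [n /= Nn <-]; exact: HN.
by apply: ereal_sup_ubound; exists N.
Qed.

Lemma limn_einf_le u (l : \bar R) : (forall n, u n <= l)%E -> (limn_einf u <= l)%E.
Proof.
move=> H; rewrite limn_einf_lim (cvg_lim _ (@cvg_einfs_sup _ u))//.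
apply: ge_ereal_sup => _ [n _ <-]; apply: le_trans (H n).
by apply: ereal_inf_lbound; exists n => /=.
Qed.

End liminf.

Section lip.
Context {R : realType}.
Implicit Types f : R -> R.

Lemma lip_continuous L f : 0 <= L -> lip L f -> continuous f.
Proof.
move=> L0 fL x; apply/cvgrPdist_le => e e0.
have L1 : 0 < L + 1 by lra.
near=> y; apply: (le_trans (fL x y)).
have : `|x - y| <= e / (L + 1).
  near: y; apply: cvgr_dist_le; [exact: cvg_id|exact: divr_gt0].
rewrite ler_pdivlMr// mulrDr mulr1 => H.
by have := normr_ge0 (x - y); lra.
Unshelve. all: by end_near. Qed.

Lemma dist_expR_le (m a b : R) : a <= m -> b <= m ->
  `|expR a - expR b| <= expR m * `|a - b|.
Proof.
wlog ab : a b / b <= a => [H am bm|am _].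
  have [ab|/ltW ab] := leP b a; first exact: H.
  by rewrite distrC (distrC a); exact: H.
rewrite !ger0_norm ?subr_ge0 ?ler_expR//.
have -> : expR a - expR b = expR a * (1 - expR (b - a)).
  by rewrite mulrBr mulr1 -expRD; congr (_ - expR _); ring.
have := expR_ge1Dx (b - a) => H.
apply: (@le_trans _ _ (expR a * (a - b))).
  by rewrite ler_wpM2l ?expR_ge0//; lra.
by rewrite ler_wpM2r ?ler_expR ?subr_ge0.
Qed.

Lemma lip_locally L f : lip L f -> [locally [lipschitz f x | x in setT]].
Proof.
move=> fL; apply: lipschitz_locally; apply: (@klipschitzW _ _ _ L).
  exact: (@globally_properfilter _ _ (0, 0)).
by move=> [x y] _ /=; exact: fL.
Qed.

End lip.

(** * The infimum-convolution inequality on the line *)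

(** Here [z] and [z'] stand for [Z t] and [Z (t + h)], [l] for [ln z], [I] for the integral of
    [v * E], and [J] for that of the time decrease of [v] per unit of time, weighted by [E]. *)
Lemma entropy_step_arith (R : realType) (a t h z z' l I J k eps : R) : 0 <= t -> 0 <= h ->
  t * k * h <= eps / 2 ->
  a * t * I - z * l - eps / 2 <= a * t ^+ 2 * J ->
  z' <= z + a * h * I - a * t * h * J + h * (k * h) ->
  t * (z' - z) <= h * (z * l + eps).
Proof.
move=> t0 h0 /(ler_wpM2l h0) H1 /(ler_wpM2l h0) H2.
by move=> /(ler_wpM2l t0) H3; lra.
Qed.

Section infimum_convolution.
Context {R : realType} (mu : probability (measurableTypeR R) R)
  (H c f : R -> R) (kappa alpha T r L C B : R).
(** Formally [t Z' - Z ln Z] is the entropy of [E t] minus [alpha * t ^+ 2] times the integral of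
    the dissipation of [v] against [E t]. The log-Sobolev inequality bounds the entropy through
    [H (lambda / 2 * s)] with [lambda = alpha * t], and the dissipation is at least [H (s / 2)].
    [H_scale] is the comparison between the two that makes the difference nonpositive. *)
Context (c0 : c 0 = 0) (c_ge0 : forall u, 0 <= c u)
  (c_even : forall u, c (- u) = c u)
  (c_conv : forall a b t, 0 <= t <= 1 ->
    c (t * a + (1 - t) * b) <= t * c a + (1 - t) * c b)
  (f_ge0 : forall x, 0 <= f x) (f_le : forall x, f x <= r)
  (L_ge0 : 0 <= L) (C_ge0 : 0 <= C)
  (f_lip : lip L f) (f_sc : semiconcave C f)
  (LB : forall u, L * `|u| - c u <= B)
  (H_ge0 : forall x, 0 <= H x) (H0 : H 0 = 0)
  (H_half : forall s, 0 <= s -> exists2 u, 0 <= u & H (s / 2) <= s * u - c u)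
  (kappa_gt0 : 0 < kappa) (alpha_gt0 : 0 < alpha) (T_gt0 : 0 < T)
  (H_scale : forall s lambda, 0 <= s -> 0 <= lambda -> lambda <= alpha * T ->
    alpha * kappa * H (lambda / 2 * s) <= lambda ^+ 2 * H (s / 2))
  (lsi : modified_log_Sobolev mu H kappa).

Let v := hopf_lax c f.
Let E t x := expR (alpha * t * v t x).
Let Z t := \int[mu]_x E t x.

Let v_ge0 t x : 0 <= t -> 0 <= v t x.
Proof. exact: hopf_lax_ge0. Qed.

Let v_le t x : 0 <= t -> v t x <= r.
Proof. exact: hopf_lax_le_bound. Qed.

Let v_lip t : 0 <= t -> lip L (v t).
Proof. exact: hopf_lax_lip. Qed.

Let v_noninc s t x : 0 <= s -> s <= t -> v t x <= v s x.
Proof. exact: hopf_lax_nonincreasing. Qed.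

Let v_decr s t x : 0 <= s -> s <= t -> v s x - v t x <= (t - s) * B.
Proof.
by move=> s0 st; rewrite lerBlDl; apply: (hopf_lax_decr c_ge0 f_ge0 f_lip).
Qed.

Let r_ge0 : 0 <= r. Proof. exact: le_trans (f_ge0 0) (f_le 0). Qed.

Let B_ge0 : 0 <= B.
Proof. by have := LB 0; rewrite normr0 mulr0 c0 subr0. Qed.

Let mv t : 0 <= t -> measurable_fun [set: measurableTypeR R] (v t : measurableTypeR R -> _).
Proof.
by move=> t0; apply: continuous_measurable_fun; exact: lip_continuous L_ge0 (v_lip t0).
Qed.

Let mE t : 0 <= t -> measurable_fun [set: measurableTypeR R] (E t : measurableTypeR R -> _).
Proof. by move=> t0; apply: measurable_expRM; exact: mv. Qed.

Let E_gt0 t x : 0 < E t x. Proof. exact: expR_gt0. Qed.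

Let M := expR (alpha * T * r).

Let E_le t x : 0 <= t -> t <= T -> E t x <= M.
Proof.
move=> t0 tT; rewrite ler_expR ler_pM//; last exact: v_le.
- by rewrite mulr_ge0// ltW.
- exact: v_ge0.
- by rewrite ler_wpM2l// ltW.
Qed.

Let E_ge1 t x : 0 <= t -> 1 <= E t x.
Proof.
by move=> t0; rewrite -expR0 ler_expR mulr_ge0 ?v_ge0// mulr_ge0// ltW.
Qed.

Let iE t : 0 <= t -> t <= T -> mu.-integrable setT (EFin \o E t).
Proof.
move=> t0 tT; apply: (bounded_integrable mu (M := M)); first exact: mE.
by move=> x; rewrite gtr0_norm// E_le.
Qed.

Let iEM t (g : measurableTypeR R -> R) K : 0 <= t -> t <= T ->
  measurable_fun setT g -> (forall x, `|g x| <= K) ->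
  mu.-integrable setT (EFin \o (fun x => g x * E t x)).
Proof.
move=> t0 tT mg gK; apply: (bounded_integrable mu (M := K * M)).
  by apply: measurable_funM => //; exact: mE.
move=> x; rewrite normrM ler_pM//.
by rewrite gtr0_norm// E_le.
Qed.

Let Z_ge1 t : 0 <= t -> t <= T -> 1 <= Z t.
Proof.
move=> t0 tT; rewrite -[leLHS](Rintegral_prob_cst mu); apply: le_Rintegral => //.
- apply: (bounded_integrable mu (M := 1)) => // x; by rewrite normr1.
- exact: iE.
- by move=> x _; exact: E_ge1.
Qed.

(** Hamilton-Jacobi inequality with finite steps. With [u] from [H_half], [hopf_lax_step] towards
    [x - h * u] and [x + h * u] bounds both descents of [v t] by its decrease over time [h] plus
    [h * c u]. The slope bound at distance [h * u] then compares [s * u - c u] with the decrease per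
    unit of time. *)
Let dissipation t x s B0 z0 : 0 <= t -> 0 <= s -> 0 <= B0 -> 0 < z0 ->
  (forall z q, 0 < z -> z <= z0 -> 0 <= q ->
    v t x - v t (x - z) <= q -> v t x - v t (x + z) <= q ->
    s * z <= q + B0 * z ^+ 2) ->
  exists K h0, [/\ 0 <= K, 0 < h0 & forall h, 0 < h -> h <= h0 ->
    H (s / 2) - K * h <= (v t x - v (t + h) x) / h].
Proof.
move=> t0 s0 B00 z00 sl; have [u u0 Hu] := H_half s0.
exists (B0 * u ^+ 2), (z0 / (u + 1)); split.
- by rewrite mulr_ge0// sqr_ge0.
- by rewrite divr_gt0//; lra.
move=> h h0; rewrite ler_pdivlMr; last lra.
move=> hz; rewrite ler_pdivlMr//.
have th : 0 < t + h by exact: ltr_wpDl.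
(* The slope bound needs a positive distance [h * u]; if [u = 0], the choice of [u] already gives
   [H (s / 2) <= 0]. *)
have [u00|un0] := eqVneq u 0.
  have : v (t + h) x <= v t x by apply: v_noninc => //; rewrite lerDl ltW.
  have : H (s / 2) * h <= 0 by rewrite pmulr_lle0//; move: Hu; rewrite u00 c0; lra.
  by rewrite u00; lra.
have hu : 0 < h * u by rewrite mulr_gt0// lt0r un0.
have step1 : v (t + h) x <= v t (x - h * u) + h * c u.
  by apply: hopf_lax_step => //; exact: ltW.
have step2 : v (t + h) x <= v t (x + h * u) + h * c u.
  have := @hopf_lax_step _ c f c_ge0 c_conv f_ge0 t h x (- u) t0 (ltW h0) th.
  by rewrite c_even mulrN opprK.
have hc : 0 <= h * c u by rewrite mulr_ge0// ltW.
have vv : v (t + h) x <= v t x by apply: v_noninc => //; rewrite lerDl ltW.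
have := sl (h * u) (v t x - v (t + h) x + h * c u) hu.
have -> : h * u <= z0 by apply: le_trans hz; rewrite ler_wpM2l ?ltW//; lra.
have : h * H (s / 2) <= h * (s * u - c u) by rewrite ler_wpM2l// ltW.
move=> Hh /(_ isT) /(_ _) H3.
have : s * (h * u) <= v t x - v (t + h) x + h * c u + B0 * (h * u) ^+ 2.
  by apply: H3; lra.
lra.
Qed.

Let Entr t := \int[mu]_x (alpha * t * v t x * E t x) - Z t * ln (Z t).

Let G t h x := (v t x - v (t + h) x) / h.

Let G_ge0 t h x : 0 <= t -> 0 < h -> 0 <= G t h x.
Proof.
move=> t0 h0; rewrite divr_ge0 ?subr_ge0//; last exact: ltW.
by apply: v_noninc => //; rewrite lerDl ltW.
Qed.

Let G_le t h x : 0 <= t -> 0 < h -> G t h x <= B.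
Proof.
move=> t0 h0; rewrite ler_pdivrMr// mulrC.
have := @v_decr t (t + h) x t0; rewrite (_ : t + h - t = h); last ring.
by apply; rewrite lerDl ltW.
Qed.

Let mG t h : 0 <= t -> 0 < h ->
  measurable_fun [set: measurableTypeR R] (G t h : measurableTypeR R -> _).
Proof.
move=> t0 h0; apply: measurable_funM => //; apply: measurable_funB; apply: mv => //.
by rewrite addr_ge0// ltW.
Qed.

Let iGE t h : 0 <= t -> t <= T -> 0 < h ->
  mu.-integrable setT (EFin \o (fun x => G t h x * E t x)).
Proof.
move=> t0 tT h0; apply: (@iEM _ _ B) => //; first exact: mG.
by move=> x; rewrite ger0_norm ?G_ge0// G_le.
Qed.

Let lsi_at t : 0 < t -> t <= T ->
  ((Entr t)%:E <= kappa%:E *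
    energy mu H (fun x => expR (alpha * t / 2 * v t x)))%E.
Proof.
move=> t0 tT; have t0' := ltW t0.
pose F := fun x => expR (alpha * t / 2 * v t x).
have FE x : F x ^+ 2 = E t x.
  by rewrite expr2 -expRD; congr expR; field.
have Flip : [locally [lipschitz F x | x in setT]].
  apply: (@lip_locally _ (M * (alpha * t / 2 * L))) => x y.
  have at2 : 0 <= alpha * t / 2 by rewrite divr_ge0// mulr_ge0// ltW.
  have F_le w : alpha * t / 2 * v t w <= alpha * T * r.
    rewrite ler_pM ?v_le ?v_ge0// ler_pdivrMr// -mulrA ler_wpM2l//; last lra.
    exact: ltW.
  apply: (le_trans (dist_expR_le (F_le x) (F_le y))).
  rewrite -[leRHS]mulrA ler_wpM2l ?expR_ge0// -mulrBr normrM ger0_norm//.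
  by rewrite -[leRHS]mulrA ler_wpM2l// v_lip.
have FI : mu.-integrable setT (fun x => (F x ^+ 2)%:E).
  by under eq_fun do rewrite FE; exact: iE.
have := lsi Flip FI; apply: le_trans.
rewrite (_ : (fun x => F x ^+ 2) = E t); last exact/funext.
rewrite /Ent (_ : (fun x => (E t x * ln (E t x))%:E) =
    EFin \o (fun x => alpha * t * v t x * E t x)); last first.
  by apply/funext => x /=; rewrite expRK mulrC.
have iA : mu.-integrable setT (EFin \o (fun x => alpha * t * v t x * E t x)).
  apply: (@iEM _ _ (alpha * T * r)) => //.
    by apply: measurable_funM => //; exact: mv.
  move=> x; rewrite ger0_norm; last by rewrite mulr_ge0 ?v_ge0// mulr_ge0// ltW.
  rewrite ler_pM ?v_le ?v_ge0//; first by rewrite mulr_ge0// ltW.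
  by rewrite ler_wpM2l// ltW.
rewrite -(EFin_Rintegral iA) -(EFin_Rintegral (iE t0' tT)).
by rewrite lne_EFin// (lt_le_trans _ (Z_ge1 t0' tT)).
Qed.

(** The constants of [dissipation] depend on [x], so the pointwise bound reaches the integral only
    through Fatou's lemma. Arguing by contradiction along a sequence of steps tending to 0 yields
    one good step below [delta]. *)
Let entropy_step t eps delta : 0 < t -> t <= T -> 0 < eps -> 0 < delta ->
  exists h, [/\ 0 < h, h < delta &
    Entr t - eps <= alpha * t ^+ 2 * \int[mu]_x (G t h x * E t x)].
Proof.
move=> t0 tT eps0 delta0; have t0' := ltW t0.
apply: contrapT => noh.
have {noh} Hh h : 0 < h -> h < delta ->
    alpha * t ^+ 2 * (\int[mu]_x (G t h x * E t x)) < Entr t - eps.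
  by move=> h0 hd; rewrite ltNge; apply/negP => Hh; apply: noh; exists h.
(* [n.+2] keeps even [h 0] strictly below [delta]. *)
pose h n : R := delta / n.+2%:R.
have h_gt0 n : 0 < h n by rewrite divr_gt0.
have h_lt n : h n < delta by rewrite ltr_pdivrMr// ltr_pMr// ltr1n.
have h_small d : 0 < d -> exists N, forall n, (N <= n)%N -> h n <= d.
  move=> d0; exists (Num.bound (delta / d)) => n Nn.
  rewrite ler_pdivrMr// mulrC -ler_pdivrMr//.
  apply: (le_trans (ltW (archi_boundP _))); first by rewrite divr_ge0// ltW.
  by rewrite ler_nat (leq_trans Nn)// -addn2 leq_addr.
(* [H_scale] at [lambda = alpha * t] reads [H (alpha * t / 2 * s) <= A * H (s / 2)]. *)
pose A := alpha * t ^+ 2 / kappa.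
have A0 : 0 < A by rewrite divr_gt0// mulr_gt0// exprn_gt0.
pose u n x := A * (G t (h n) x * E t x).
pose F := fun x => expR (alpha * t / 2 * v t x).
have FE x : F x ^+ 2 = E t x.
  by rewrite expr2 -expRD; congr expR; field.
have pointwise x : ((H (fine (metric_slope F x) / F x) * F x ^+ 2)%:E <=
    limn_einf (fun n => (u n x)%:E))%E.
  have at0 : 0 < alpha * t by rewrite mulr_gt0.
  pose s := 2 / (alpha * t) * (fine (metric_slope F x) / F x).
  have [s0 [B0 [z0 [B00 z00 sl]]]] := slope_expR_le x L_ge0 C_ge0 at0 (v_lip t0')
    (hopf_lax_semiconcave c_ge0 f_ge0 f_sc t0').
  have {}s0 : 0 <= s by exact: s0.
  have [K [h0 [K0 h00 Kh]]] := dissipation t0' s0 B00 z00 sl.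
  have -> : fine (metric_slope F x) / F x = alpha * t / 2 * s.
    by rewrite /s; field; rewrite /F !gt_eqF// expR_gt0.
  rewrite FE; have HA : H (alpha * t / 2 * s) <= A * H (s / 2).
    have := H_scale s0 (ltW at0); rewrite ler_wpM2l ?(ltW alpha_gt0)// => /(_ isT) HS.
    rewrite /A [leRHS]mulrAC ler_pdivlMr//.
    by rewrite -(ler_pM2l alpha_gt0); lra.
  apply: (@le_trans _ _ (A * H (s / 2) * E t x)%:E).
    by rewrite lee_fin ler_wpM2r// ltW.
  apply: le_limn_einf => e e0.
  pose D := A * K * E t x + 1.
  have D0 : 0 < D.
    rewrite ltr_wpDl//; apply: mulr_ge0; last exact: ltW.
    by apply: mulr_ge0 => //; exact: ltW.
  have [N1 HN1] := h_small _ h00.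
  have [N2 HN2] := h_small (e / D) (divr_gt0 e0 D0).
  exists (maxn N1 N2) => n; rewrite geq_max => /andP[/HN1 h1 /HN2].
  rewrite ler_pdivlMr// => h2; rewrite lee_fin /u.
  have : A * E t x * (H (s / 2) - K * h n) <= A * E t x * G t (h n) x.
    by rewrite ler_wpM2l ?Kh//; apply: mulr_ge0; exact: ltW.
  have : 0 < h n by [].
  by rewrite /D in h2; lra.
have mu_ n : measurable_fun [set: measurableTypeR R] (fun x : measurableTypeR R => (u n x)%:E).
  apply/measurable_EFinP; apply: measurable_funM => //; apply: measurable_funM.
    exact: mG.
  exact: mE.
have u0 n x : [set: measurableTypeR R] x -> (0 <= (u n x)%:E)%E.
  move=> _; rewrite lee_fin mulr_ge0 ?(ltW A0)// mulr_ge0 ?(ltW (E_gt0 _ _))//.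
  exact: G_ge0.
have := lsi_at t0 tT; rewrite leNgt => /negP; apply.
rewrite /energy -/F.
apply: (@le_lt_trans _ _ (kappa%:E * ((Entr t - eps) / kappa)%:E)%E); last first.
  by rewrite -EFinM lte_fin mulrC divfK ?gt_eqF//; lra.
apply: lee_wpmul2l; first by rewrite lee_fin ltW.
have e0 x : (0 <= (H (fine (metric_slope F x) / F x) * F x ^+ 2)%:E)%E.
  by rewrite lee_fin mulr_ge0// sqr_ge0.
apply: (le_trans (@ge0_le_integral_nomeas _ (measurableTypeR R) _ mu _ _ e0 pointwise)).
apply: (le_trans (fatou mu measurableT mu_ u0)).
apply: limn_einf_le => n.
rewrite -EFin_Rintegral; last first.
  apply: (bounded_integrable mu (M := A * (B * M))).
    by apply/measurable_EFinP; exact: mu_.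
  move=> x; rewrite ger0_norm -?lee_fin ?u0// lee_fin.
  rewrite ler_wpM2l ?(ltW A0)// ler_pM ?G_ge0 ?G_le ?E_le// ltW//.
rewrite lee_fin /u RintegralZl//; last exact: iGE.
rewrite ler_pdivlMr// (_ : A * _ * kappa =
    alpha * t ^+ 2 * (\int[mu]_x (G t (h n) x * E t x))).
  by rewrite ltW// Hh.
by rewrite /A; field; rewrite gt_eqF.
Qed.

(** Bounds the change per unit of time of the exponent [alpha * t * v t x]: the first term comes
    from the factor [t], the second from the decrease of [v]. *)
Let K1 := alpha * r + alpha * T * B.

(** Integrates [E (t + h) x = E t x * expR d] with [expR d <= 1 + d + 2 * d ^+ 2]. In the linear
    term, [v (t + h) x] is replaced by the larger [v t x]. *)
Let Z_step t h : 0 < t -> 0 < h -> t + h <= T -> K1 * h <= 2^-1 ->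
  Z (t + h) <= Z t + alpha * h * (\int[mu]_x (v t x * E t x))
    - alpha * t * h * (\int[mu]_x (G t h x * E t x)) + 2 * M * (K1 * h) ^+ 2.
Proof.
move=> t0 h0 thT K1h; have t0' := ltW t0; have h0' := ltW h0.
have tT : t <= T by lra.
have th0 : 0 <= t + h by exact: addr_ge0.
have ivE : mu.-integrable setT (EFin \o (fun x => v t x * E t x)).
  by apply: (@iEM _ _ r) => //; [exact: mv|move=> x; rewrite ger0_norm ?v_ge0// v_le].
have iGE' := iGE t0' tT h0.
have ic (k : R) : mu.-integrable setT (EFin \o (fun=> k)).
  exact: (bounded_integrable mu (M := `|k|)).
have iZ (g : R -> R) k : mu.-integrable setT (EFin \o g) ->
    mu.-integrable setT (EFin \o (fun x => k * g x)).
  by move=> ig; exact: (integrableZl measurableT k ig).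
have iD (g1 g2 : R -> R) : mu.-integrable setT (EFin \o g1) ->
    mu.-integrable setT (EFin \o g2) ->
    mu.-integrable setT (EFin \o (fun x => g1 x + g2 x)).
  by move=> ig1 ig2; exact: (integrableD measurableT ig1 ig2).
have iA : mu.-integrable setT
    (EFin \o (fun x => E t x + alpha * h * (v t x * E t x))).
  by apply: iD; [exact: iE|exact: iZ].
have iB : mu.-integrable setT (EFin \o (fun x => E t x
    + alpha * h * (v t x * E t x) + - (alpha * t * h) * (G t h x * E t x))).
  by apply: iD => //; exact: iZ.
rewrite -(Rintegral_prob_cst mu (2 * M * (K1 * h) ^+ 2)).
rewrite -mulNr -(RintegralZl _ _ ivE)// -(RintegralZl _ _ iGE')//.
rewrite -(RintegralD _ (iE _ _) (iZ _ _ ivE))// -(RintegralD _ iA (iZ _ _ iGE'))//.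
rewrite -(RintegralD _ iB (ic _))//.
apply: le_Rintegral => //; first exact: iE.
  by apply: iD => //; exact: ic.
move=> x _.
have hG : h * G t h x = v t x - v (t + h) x by rewrite /G mulrC divfK ?gt_eqF.
have v0 := v_ge0 x t0'; have vr := v_le x t0'.
have v'0 := v_ge0 x th0; have v'r := v_le x th0.
have vv' : 0 <= v t x - v (t + h) x.
  by rewrite -hG mulr_ge0// G_ge0.
have vB : v t x - v (t + h) x <= h * B by rewrite -hG ler_wpM2l// G_le.
pose d := alpha * (t + h) * v (t + h) x - alpha * t * v t x.
have dE : d = alpha * h * v (t + h) x - alpha * t * (v t x - v (t + h) x).
  by rewrite /d; ring.
have a1 : 0 <= alpha * h * v (t + h) x by rewrite !mulr_ge0// ltW.
have a2 : alpha * h * v (t + h) x <= alpha * h * r.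
  by rewrite ler_wpM2l// mulr_ge0// ltW.
have a2' : alpha * h * v (t + h) x <= alpha * h * v t x.
  by rewrite ler_wpM2l//; [rewrite mulr_ge0// ltW|lra].
have at0 : 0 <= alpha * t by rewrite mulr_ge0// ltW.
have a3 : 0 <= alpha * t * (v t x - v (t + h) x) by rewrite mulr_ge0.
have a4 : alpha * t * (v t x - v (t + h) x) <= alpha * T * (h * B).
  by rewrite ler_pM// ler_wpM2l// ltW.
have hr0 : 0 <= alpha * h * r by rewrite !mulr_ge0// ltW.
have hB0 : 0 <= alpha * T * (h * B) by apply: le_trans a4.
have dK : `|d| <= K1 * h by rewrite ler_norml dE /K1; apply/andP; split; lra.
have d2 : d ^+ 2 <= (K1 * h) ^+ 2.
  by rewrite -real_normK ?num_real// ler_sqr ?nnegrE// (le_trans _ dK).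
have := expR_le_quadratic (le_trans (ler_norm d) (le_trans dK K1h)).
move=> /(ler_wpM2l (ltW (E_gt0 t x))).
rewrite {1}/E -expRD (_ : alpha * t * v t x + d = alpha * (t + h) * v (t + h) x); last by rewrite /d; ring.
rewrite -/(E (t + h) x) => /le_trans; apply.
have e1 : E t x * d <= E t x * (alpha * h * v t x - alpha * t * (h * G t h x)).
  by rewrite ler_wpM2l ?(ltW (E_gt0 _ _))// hG dE; lra.
have e2 : E t x * d ^+ 2 <= M * (K1 * h) ^+ 2.
  by rewrite ler_pM ?sqr_ge0// ?(ltW (E_gt0 _ _))// E_le.
lra.
Qed.


Let K1_ge0 : 0 <= K1.
Proof. by rewrite addr_ge0// mulr_ge0// ?mulr_ge0// ltW. Qed.

Let Z_step_le t eps : 0 < t -> t < T -> 0 < eps -> exists h,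
  [/\ 0 < h, t + h <= T & t * (Z (t + h) - Z t) <= h * (Z t * ln (Z t) + eps)].
Proof.
move=> t0 tT eps0; have t0' := ltW t0; have tT' := ltW tT.
pose K2 := 2 * M * K1 ^+ 2.
have K20 : 0 <= K2 by rewrite mulr_ge0 ?sqr_ge0// mulr_ge0// expR_ge0.
have e0 : 0 < eps / 2 by rewrite divr_gt0.
pose d1 := 2^-1 / (K1 + 1).
have K11 : 0 < K1 + 1 by exact: ltr_wpDl.
have tK21 : 0 < t * K2 + 1 by rewrite ltr_wpDl// mulr_ge0.
have d10 : 0 < d1 by rewrite divr_gt0.
pose d2 := eps / 2 / (t * K2 + 1).
have d20 : 0 < d2 by rewrite divr_gt0.
(* The three bounds keep [t + h] below [T], [K1 * h] below 1/2 and the second-order remainder below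
   [eps / 2]; the other [eps / 2] is left to [entropy_step]. *)
have d0 : 0 < Num.min (T - t) (Num.min d1 d2) by rewrite !lt_min subr_gt0 tT d10.
have [h [h0 hd He]] := entropy_step t0 tT' e0 d0.
move: hd; rewrite !lt_min => /and3P[hT hd1 hd2].
have thT : t + h <= T by lra.
exists h; split=> //.
have th : 0 < t + h by exact: addr_gt0.
have hK1 : K1 * h <= 2^-1.
  by move: hd1; rewrite /d1 ltr_pdivlMr//; lra.
have hK2 : t * K2 * h <= eps / 2.
  by move: hd2; rewrite /d2 ltr_pdivlMr//; lra.
have ivE : mu.-integrable setT (EFin \o (fun x => v t x * E t x)).
  by apply: (@iEM _ _ r) => //; [exact: mv|move=> x; rewrite ger0_norm ?v_ge0// v_le].
have HZ := Z_step t0 h0 thT hK1; move: He.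
rewrite /Entr (_ : \int[mu]_x _ = alpha * t * \int[mu]_x (v t x * E t x)); last first.
  by rewrite -RintegralZl//; apply: eq_Rintegral => x _; rewrite mulrA.
move=> He; apply: (entropy_step_arith t0' (ltW h0) hK2 He); apply: (le_trans HZ).
by rewrite lerD2l le_eqVlt; apply/orP; left; apply/eqP; rewrite /K2; ring.
Qed.

Let Z_lip s t : 0 < s -> s <= t -> t <= T ->
  Z t <= expR (alpha * r * (t - s)) * Z s.
Proof.
move=> s0 st tT.
have t'0 : 0 < t by exact: lt_le_trans st.
have sT : s <= T by exact: le_trans tT.
rewrite /Z -RintegralZl//; last by apply: iE => //; exact: ltW.
apply: le_Rintegral => //; first by apply: iE => //; exact: ltW.
  exact: (integrableZl measurableT _ (iE (ltW s0) sT)).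
move=> x _; rewrite -expRD ler_expR.
have vts := @v_noninc s t x (ltW s0) st; have vr := v_le x (ltW t'0).
have : alpha * s * v t x <= alpha * s * v s x.
  by rewrite ler_wpM2l// mulr_ge0// ltW.
have : alpha * (t - s) * v t x <= alpha * (t - s) * r.
  by rewrite ler_wpM2l// mulr_ge0 ?subr_ge0// ltW.
lra.
Qed.

Let Z_start t : 0 < t -> t <= T -> alpha * t * r <= 2^-1 ->
  Z t <= 1 + alpha * (\int[mu]_x f x) * t + 2 * (alpha * r) ^+ 2 * t ^+ 2.
Proof.
move=> t0 tT atr; have t0' := ltW t0.
have ic (k : R) : mu.-integrable setT (EFin \o (fun=> k)).
  exact: (bounded_integrable mu (M := `|k|)).
have mf : measurable_fun [set: measurableTypeR R] (f : measurableTypeR R -> _).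
  by apply: continuous_measurable_fun; exact: lip_continuous L_ge0 f_lip.
have if_ : mu.-integrable setT (EFin \o (f : measurableTypeR R -> R)).
  by apply: (bounded_integrable mu (M := r)) => // x; rewrite ger0_norm.
have iaf := integrableZl measurableT (alpha * t) if_.
have i1 := integrableD measurableT (ic 1) iaf.
have at0 : 0 <= alpha * t by rewrite mulr_ge0// ltW.
rewrite (mulrAC alpha) -[2 * _ * _]mulrA -exprMn (mulrAC alpha r).
rewrite -[X in _ <= X + _ + _](Rintegral_prob_cst mu) -(RintegralZl _ _ if_)//.
rewrite -[X in _ <= _ + X](Rintegral_prob_cst mu).
rewrite -(RintegralD _ (ic 1) iaf)// -(RintegralD _ i1 (ic _))//.
apply: le_Rintegral => //; first exact: iE.
  exact: (integrableD measurableT i1 (ic _)).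
move=> x _; have vx := v_le x t0'; have v0 := v_ge0 x t0'.
have h1 : alpha * t * v t x <= alpha * t * r by rewrite ler_wpM2l.
have h0 : 0 <= alpha * t * v t x by rewrite mulr_ge0.
apply: (le_trans (expR_le_quadratic (le_trans h1 atr))).
apply: lerD => /=; last by rewrite ler_wpM2l// ler_sqr ?nnegrE// (le_trans h0).
by rewrite lerD2l ler_wpM2l// hopf_lax_le0.
Qed.

Theorem infimum_convolution_inequality :
  \int[mu]_x expR (alpha * T * hopf_lax c f T x)
    <= expR (alpha * T * \int[mu]_x f x).
Proof.
have ar : 0 <= alpha * r by rewrite mulr_ge0// ltW.
have ar1 : 0 < 2 * (alpha * r) + 1 by rewrite ltr_wpDl// mulr_ge0.
rewrite mulrAC.
(* The starting range ensures [alpha * t * r <= 1/2], where the exponential is expanded; there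
   [ln Z / t] is at most [alpha] times the mean of [f], up to an error linear in [t]. *)
apply: (@herbst _ Z T (alpha * r) _ (2 * (alpha * r) ^+ 2)
  (1 / (2 * (alpha * r) + 1)) T_gt0 ar) => //.
- by rewrite mulr_ge0// sqr_ge0.
- by rewrite divr_gt0.
- by move=> t t0; exact: Z_ge1 (ltW t0).
- move=> t t0 tT; rewrite ler_pdivlMr// => tr; apply: Z_start => //; lra.
Qed.

End infimum_convolution.

(** * Measurability on tuples *)

Section tuples.
Context {R : realType}.

Local Notation Rn n := (n.-tuple (measurableTypeR R)).

(** Retypes the entry from [measurableTypeR R] to [R], so that arithmetic applies to it. *)
Definition coord n (x : Rn n) (i : 'I_n) : R := tnth x i.

Definition mktuple_R n (F : 'I_n -> R) : Rn n := [tuple (F i : measurableTypeR R) | i < n].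

Lemma coord_mktuple n (F : 'I_n -> R) i : coord (mktuple_R F) i = F i.
Proof. by rewrite /coord tnth_mktuple. Qed.

Lemma coord_cons0 n (p : measurableTypeR R * Rn n) : coord (cons_pair p) ord0 = p.1.
Proof. by rewrite /coord tnth0. Qed.

Lemma coord_consS n (p : measurableTypeR R * Rn n) i :
  coord (cons_pair p) (lift ord0 i) = coord p.2 i.
Proof. by rewrite /coord tnthS. Qed.

Lemma cons_pair_mktuple n (F : 'I_n.+1 -> R) :
  mktuple_R F = cons_pair (F ord0, mktuple_R (fun i => F (lift ord0 i))).
Proof.
apply: eq_from_tnth => i; rewrite -![tnth _ _]/(coord _ _) coord_mktuple.
by case: (unliftP ord0 i) => [j ->|->]; rewrite ?coord_cons0 ?coord_consS ?coord_mktuple.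
Qed.

(** [U] is the union of the rational boxes it contains. These are countably many, and each is a
    finite intersection of preimages under the coordinates. *)
Lemma open_measurable n (U : set (Rn n)) :
  (forall x, U x -> exists2 e : R, 0 < e &
     forall y, (forall i, `|coord x i - coord y i| < e) -> U y) ->
  measurable U.
Proof.
move=> Uopen.
pose box (p : n.-tuple rat * nat) : set (Rn n) :=
  [set x | forall i, `|coord x i - ratr (tnth p.1 i)| < p.2.+1%:R^-1].
have mbox p : measurable (box p).
  rewrite (_ : box p = \big[setI/setT]_(i < n) ((fun x : Rn n => tnth x i) @^-1`
      ((fun y : measurableTypeR R => `|(y : R) - ratr (tnth p.1 i)|) @^-1` `]-oo, p.2.+1%:R^-1[))).
    apply: bigsetI_measurable => i _; rewrite -[X in measurable X]setTI.
    apply: measurable_tnth => //; rewrite -[X in measurable X]setTI.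
    have : measurable_fun [set: measurableTypeR R]
        (fun y : measurableTypeR R => `|(y : R) - ratr (tnth p.1 i)|).
      by apply: measurableT_comp => //; exact: measurable_funB.
    by apply => //; exact: measurable_itv.
  rewrite -bigcap_seq; apply/seteqP; split=> x /= Hx i => [_|].
    by rewrite /= in_itv /=; exact: Hx.
  by have := Hx i; rewrite /= in_itv /=; apply; rewrite mem_index_enum.
rewrite (_ : U = \bigcup_p (if `[< box p `<=` U >] then box p else set0)).
  apply: countable_bigcupT_measurable; first exact: countableP.
  by move=> p; case: asboolP.
apply/seteqP; split=> [x Ux|x [p _]]; last by case: asboolP => // + px; apply.
have [e e0 He] := Uopen x Ux.
(* Two points of a box of radius [m.+1%:R^-1] differ by less than [2 / m.+1 < e] in each
   coordinate. *)
pose m := Num.bound (2 / e).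
have me : 2 * m.+1%:R^-1 < e :> R.
  rewrite ltr_pdivrMr// mulrC -ltr_pdivrMr//.
  apply: (lt_trans (archi_boundP _)); first by rewrite divr_ge0// ltW.
  by rewrite ltr_nat.
have m0 : 0 < m.+1%:R^-1 :> R by rewrite invr_gt0.
have Hq i : exists q : rat, `|coord x i - ratr q| < m.+1%:R^-1.
  move: m0; set a := _^-1; move: a => a a0.
  have [|q] := @rat_in_itvoo R (coord x i - a) (coord x i + a); first by lra.
  by rewrite in_itv/= => /andP[q1 q2]; exists q; rewrite ltr_norml; apply/andP; split; lra.
pose q i := projT1 (cid (Hq i)).
have qP i : `|coord x i - ratr (q i)| < m.+1%:R^-1 := projT2 (cid (Hq i)).
exists ([tuple q i | i < n], m) => //; rewrite ifT.
  by move=> i /=; rewrite tnth_mktuple.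
apply/asboolP => y Hy; apply: He => i; apply: le_lt_trans me.
have := Hy i; rewrite /= tnth_mktuple => Hyi.
apply: (le_trans (ler_distD (ratr (q i)) _ _)).
by rewrite mulr2n mulrDl mul1r lerD// ltW// distrC.
Qed.

Definition lipn n (L : R) (F : Rn n -> R) := forall x y,
  `|F x - F y| <= L * \sum_(i < n) `|coord x i - coord y i|.

Lemma lipn_measurable n L (F : Rn n -> R) : 0 <= L -> lipn L F ->
  measurable_fun setT F.
Proof.
move=> L0 FL.
apply: (@measurability _ _ _ _ _ _ (@RGenOInfty.G R)); first exact: RGenOInfty.measurableE.
move=> _ [_ [a ->] <-]; rewrite setTI; apply: open_measurable => x /=.
rewrite in_itv/= andbT => ax.
have D0 : 0 < L * n%:R + 1 by rewrite ltr_wpDl// mulr_ge0.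
exists ((F x - a) / (L * n%:R + 1)); first by rewrite divr_gt0// subr_gt0.
move=> y xy; rewrite /preimage/= in_itv/= andbT.
have : `|F x - F y| < F x - a.
  apply: (le_lt_trans (FL x y)).
  set e := (F x - a) / _ in xy *.
  have e0 : 0 < e by rewrite divr_gt0// subr_gt0.
  have -> : F x - a = (L * n%:R + 1) * e by rewrite mulrC divfK// gt_eqF.
  apply: (@le_lt_trans _ _ (L * (n%:R * e))); last by lra.
  rewrite ler_wpM2l//; apply: (@le_trans _ _ (\sum_(i < n) e)).
    by apply: ler_sum => i _; exact: ltW.
  by rewrite sumr_const card_ord mulr_natl.
by move=> /(le_lt_trans (ler_norm _)); lra.
Qed.

End tuples.

(** * Tensorization *)

Section bounded_integral_inequalities.
Context d (T : measurableType d) {R : realType} (mu : probability T R) (r : R).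
Implicit Types f g h : T -> R.

Let int_bnd f : measurable_fun setT f -> (forall x, 0 <= f x <= r) ->
  mu.-integrable setT (EFin \o f).
Proof.
move=> mf f0r; apply: (bounded_integrable mu (M := r)) => // x.
by have /andP[f0 fr] := f0r x; rewrite ger0_norm.
Qed.

Let int_cst (k : R) : mu.-integrable setT (EFin \o (fun=> k)).
Proof. exact: (bounded_integrable mu (M := `|k|)). Qed.

Lemma Rintegral_bound f : measurable_fun setT f -> (forall x, 0 <= f x <= r) ->
  0 <= \int[mu]_x f x <= r.
Proof.
move=> mf f0r; rewrite -[X in _ <= _ <= X](Rintegral_prob_cst mu).
rewrite Rintegral_ge0/=; last by move=> x _; have /andP[] := f0r x.
apply: le_Rintegral => //; first exact: int_bnd.
by move=> x _; have /andP[] := f0r x.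
Qed.

Lemma Rintegral_leD f g e : measurable_fun setT f -> (forall x, 0 <= f x <= r) ->
  measurable_fun setT g -> (forall x, 0 <= g x <= r) ->
  (forall x, f x <= g x + e) -> \int[mu]_x f x <= \int[mu]_x g x + e.
Proof.
move=> mf f0r mg g0r fg; rewrite -[X in _ + X](Rintegral_prob_cst mu).
have ig := int_bnd mg g0r.
rewrite -(RintegralD _ ig (int_cst e))//; apply: le_Rintegral => //.
  exact: int_bnd.
exact: (integrableD measurableT ig (int_cst e)).
Qed.

Lemma Rintegral_convD f g h t e : measurable_fun setT f -> (forall x, 0 <= f x <= r) ->
  measurable_fun setT g -> (forall x, 0 <= g x <= r) ->
  measurable_fun setT h -> (forall x, 0 <= h x <= r) ->
  (forall x, t * f x + (1 - t) * g x <= h x + e) ->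
  t * (\int[mu]_x f x) + (1 - t) * (\int[mu]_x g x) <= \int[mu]_x h x + e.
Proof.
move=> mf f0r mg g0r mh h0r fg; rewrite -[X in _ <= _ + X](Rintegral_prob_cst mu).
have if_ := int_bnd mf f0r; have ig := int_bnd mg g0r; have ih := int_bnd mh h0r.
have itf : mu.-integrable setT (EFin \o (fun x => t * f x)).
  exact: (integrableZl measurableT t if_).
have itg : mu.-integrable setT (EFin \o (fun x => (1 - t) * g x)).
  exact: (integrableZl measurableT (1 - t) ig).
rewrite -(RintegralZl _ _ if_)// -(RintegralZl _ _ ig)//.
rewrite -(RintegralD _ itf itg)// -(RintegralD _ ih (int_cst e))//.
apply: le_Rintegral => //; first exact: (integrableD measurableT itf itg).
exact: (integrableD measurableT ih (int_cst e)).
Qed.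

End bounded_integral_inequalities.

Section tensorization.
Context {R : realType} (mu : probability (measurableTypeR R) R).

Local Notation Rn n := (n.-tuple (measurableTypeR R)).

Definition segment n (t : R) (x y : Rn n) : Rn n :=
  mktuple_R (fun i => t * coord x i + (1 - t) * coord y i).

Definition semiconcaven n (C : R) (F : Rn n -> R) := forall x y t, 0 <= t <= 1 ->
  t * F x + (1 - t) * F y <= F (segment t x y)
    + C * (t * (1 - t) * \sum_(i < n) (coord x i - coord y i) ^+ 2).

Definition costn n (c : R -> R) (x y : Rn n) := \sum_(i < n) c (coord x i - coord y i).

Lemma segment_cons n t (p q : measurableTypeR R * Rn n) :
  segment t (cons_pair p) (cons_pair q) =
  cons_pair (t * (p.1 : R) + (1 - t) * (q.1 : R) : measurableTypeR R, segment t p.2 q.2).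
Proof.
rewrite /segment cons_pair_mktuple !coord_cons0; congr (cons_pair (_, mktuple_R _)).
by apply/funext => i; rewrite !coord_consS.
Qed.

Lemma costn_cons n c (p q : measurableTypeR R * Rn n) :
  costn c (cons_pair p) (cons_pair q) = c ((p.1 : R) - (q.1 : R)) + costn c p.2 q.2.
Proof.
rewrite /costn big_ord_recl !coord_cons0; congr (_ + _).
by apply: eq_bigr => i _; rewrite !coord_consS.
Qed.

Lemma integral_power_probS n (g : Rn n.+1 -> R) :
  measurable_fun setT g -> (forall x, 0 <= g x) ->
  (\int[power_prob mu n.+1]_z (g z)%:E =
   \int[power_prob mu n]_y \int[mu]_x (g (cons_pair (x, y)))%:E)%E.
Proof.
move=> mg g0.
have mg' : measurable_fun setT (fun p : measurableTypeR R * Rn n => (g (cons_pair p))%:E).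
  apply/measurable_EFinP; apply: measurableT_comp => //; exact: measurable_cons_pair.
transitivity (\int[mu \x power_prob mu n]_p (g (cons_pair p))%:E)%E.
  rewrite /= ge0_integral_pushforward//=.
  - exact/measurable_EFinP.
  - by move=> y _; rewrite lee_fin.
by rewrite fubini_tonelli2// => x; rewrite lee_fin.
Qed.

Lemma cons_pair_fixed_measurable n (y : Rn n) (g : Rn n.+1 -> R) :
  measurable_fun setT g ->
  measurable_fun setT (fun x : measurableTypeR R => g (cons_pair (x, y))).
Proof.
move=> mg; apply: (measurableT_comp mg).
by apply: (measurableT_comp (measurable_cons_pair (n := n))); exact: pair2_measurable.
Qed.

Lemma lipn_cons n L (F : Rn n.+1 -> R) x y x' y' : lipn L F ->
  `|F (cons_pair (x, y)) - F (cons_pair (x', y'))| <=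
   L * (`|(x : R) - (x' : R)| + \sum_(i < n) `|coord y i - coord y' i|).
Proof.
move=> FL; apply: le_trans (FL _ _) _; rewrite big_ord_recl !coord_cons0/=.
by under eq_bigr do rewrite !coord_consS.
Qed.

Context (Lambda r : R) (c : R -> R).
Context (Lambda_ge0 : 0 <= Lambda) (c0 : c 0 = 0)
  (c_ge0 : forall u, 0 <= c u).

(** Stated for every pair with [g x <= f y + c (x - y)] rather than for the infimum-convolution
    itself: regularity is asked of [f] alone, and the sections of a merely measurable [g] are
    allowed. *)
Context (one_dim : forall L C (f g : R -> R), 0 <= L -> 0 <= C ->
  lip L f -> semiconcave C f ->
  measurable_fun [set: measurableTypeR R] (g : measurableTypeR R -> R) ->
  (forall x, 0 <= f x <= r) -> (forall x, 0 <= g x <= r) ->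
  (forall x y, g x <= f y + c (x - y)) ->
  (\int[mu]_x expR (Lambda * g x) <= expR (Lambda * \int[mu]_x f x))).

(** In the induction, [h x y] is the infimum-convolution of [f] in the last [n] variables only. For
    fixed [y] the pair [h ^~ y], [g (cons_pair (_, y))] satisfies the one-dimensional hypothesis.
    Integrating in the first variable turns [f] and [h] into [F] and [G], and
    [G y <= F y' + costn c y y'] is the hypothesis for [n]. Infima and integrals preserve the
    Lipschitz and semiconcavity constants. *)
Lemma power_prob_infimum_convolution n L C (f g : Rn n -> R) : 0 <= L -> 0 <= C ->
  lipn L f -> semiconcaven C f -> measurable_fun setT g ->
  (forall x, 0 <= f x <= r) -> (forall x, 0 <= g x <= r) ->
  (forall x y, g x <= f y + costn c x y) ->
  (\int[power_prob mu n]_x (expR (Lambda * g x))%:E <=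
    (expR (Lambda * \int[power_prob mu n]_x f x))%:E)%E.
Proof.
move=> L0 C0; elim: n f g => [|n IH] f g fL fC mg f0r g0r gf.
  rewrite integral_dirac//; last first.
    by apply/measurable_EFinP; exact: measurable_expRM.
  rewrite /Rintegral integral_dirac//; last first.
    by apply/measurable_EFinP; exact: lipn_measurable fL.
  rewrite diracT !mul1e lee_fin ler_expR ler_wpM2l//.
  by have := gf [tuple] [tuple]; rewrite /costn big_ord0 addr0.
pose shift (y w : Rn n) : Rn n := mktuple_R (fun i => coord y i - coord w i).
have f0 z : 0 <= f z by have /andP[] := f0r z.
have mf := lipn_measurable L0 fL.
pose k (x : R) (y w : Rn n) :=
  f (cons_pair (x : measurableTypeR R, shift y w)) + \sum_(i < n) c (coord w i).
pose h (x : R) (y : Rn n) := inf (range (k x y)).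
have k0 x y w : 0 <= k x y w by rewrite addr_ge0// sumr_ge0.
have w0 : Rn n := mktuple_R (fun=> 0).
have h0r x y : 0 <= h x y <= r.
  apply/andP; split; first exact: (le_infr w0).
  apply: (@le_trans _ _ (k x y (mktuple_R (fun=> 0)))); first exact: infr_le (k0 x y).
  rewrite /k [X in _ + X]big1 ?addr0; last by move=> i _; rewrite coord_mktuple c0.
  by have /andP[] := f0r (cons_pair (x : measurableTypeR R, shift y (mktuple_R (fun=> 0)))).
have h_lipx y : lip L (h ^~ y).
  have H x x' : h x y <= h x' y + L * `|x - x'|.
    apply: (infr_leD w0 (k0 x y)) => w; exists w.
    rewrite /k addrAC lerD2r -lerBlDl; apply: (le_trans (ler_norm _)).
    apply: (le_trans (lipn_cons _ _ _ _ fL)).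
    by rewrite big1 ?addr0// => i _; rewrite subrr normr0.
  move=> x x'; rewrite ler_norml lerBlDl H andbT lerBrDl -lerBrDr opprK.
  by rewrite distrC; exact: H.
have h_lipy x : lipn L (h x).
  have H y y' : h x y <= h x y' + L * \sum_(i < n) `|coord y i - coord y' i|.
    apply: (infr_leD w0 (k0 x y)) => w; exists w.
    rewrite /k addrAC lerD2r -lerBlDl; apply: (le_trans (ler_norm _)).
    apply: (le_trans (lipn_cons _ _ _ _ fL)).
    rewrite subrr normr0 add0r ler_wpM2l//; apply: ler_sum => i _.
    by rewrite !coord_mktuple opprB addrA subrK.
  move=> y y'; rewrite ler_norml lerBlDl H andbT lerBrDl -lerBrDr opprK.
  by under eq_bigr do rewrite distrC; exact: H.
have h_sc y : semiconcave C (h ^~ y).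
  move=> x x' t t01; apply: (infr_conv w0 t01 (k0 x y) (k0 x' y)) => w; exists w, w.
  have := fC (cons_pair (x : measurableTypeR R, shift y w))
    (cons_pair (x' : measurableTypeR R, shift y w)) _ t01.
  rewrite segment_cons big_ord_recl !coord_cons0/= big1 ?addr0; last first.
    by move=> i _; rewrite !coord_consS subrr expr0n.
  rewrite (_ : segment t (shift y w) (shift y w) = shift y w); last first.
    apply: eq_from_tnth => i; rewrite -![tnth _ _]/(coord _ _) coord_mktuple.
    by ring.
  by rewrite /k; lra.
have h_meas y : measurable_fun [set: measurableTypeR R] (h ^~ y : measurableTypeR R -> _).
  by apply: continuous_measurable_fun; exact: lip_continuous L0 (h_lipx y).
have fx_meas y : measurable_fun [set: measurableTypeR R]
    (fun x : measurableTypeR R => f (cons_pair (x, y))).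
  exact: cons_pair_fixed_measurable.
pose F (y : Rn n) := \int[mu]_x f (cons_pair (x, y)).
pose G (y : Rn n) := \int[mu]_x h x y.
have F0r y : 0 <= F y <= r by apply: Rintegral_bound.
have G0r y : 0 <= G y <= r by apply: Rintegral_bound.
have lip_of (A : Rn n -> R) : (forall y y', A y <= A y' + L * \sum_(i < n) `|coord y i - coord y' i|) ->
    lipn L A.
  move=> H y y'; rewrite ler_norml lerBlDl H andbT lerBrDl -lerBrDr opprK.
  by under eq_bigr do rewrite distrC; exact: H.
have F_lip : lipn L F.
  apply: lip_of => y y'; apply: (Rintegral_leD mu (r := r)) => // x.
  rewrite -lerBlDl; apply: (le_trans (ler_norm _)).
  by apply: (le_trans (lipn_cons _ _ _ _ fL)); rewrite subrr normr0 add0r.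
have G_lip : lipn L G.
  apply: lip_of => y y'; apply: (Rintegral_leD mu (r := r)) => // x.
  by rewrite -lerBlDl; apply: (le_trans (ler_norm _)); exact: h_lipy.
have F_sc : semiconcaven C F.
  move=> y y' t t01; apply: (Rintegral_convD mu (r := r)) => // x.
  have := fC (cons_pair (x, y)) (cons_pair (x, y')) _ t01.
  rewrite segment_cons big_ord_recl !coord_cons0/= subrr expr0n add0r.
  under eq_bigr do rewrite !coord_consS.
  by rewrite (_ : t * (x : R) + (1 - t) * (x : R) = x) //; ring.
have GF y y' : G y <= F y' + costn c y y'.
  apply: (Rintegral_leD mu (r := r)) => // x.
  apply: (le_trans (infr_le (shift y y') (k0 x y))); rewrite /k; apply: lerD.
    rewrite le_eqVlt; apply/orP; left; apply/eqP; congr (f (cons_pair (_, _))).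
    apply: eq_from_tnth => i; rewrite -![tnth _ _]/(coord _ _) !coord_mktuple.
    by ring.
  by rewrite /costn; under eq_bigr do rewrite coord_mktuple.
have gh y : \int[mu]_x expR (Lambda * g (cons_pair (x, y))) <= expR (Lambda * G y).
  apply: (one_dim (g := fun x => g (cons_pair (x, y))) L0 C0 (h_lipx y) (h_sc y)) => //.
    exact: cons_pair_fixed_measurable.
  move=> x x'; rewrite -lerBlDr; apply: (le_infr w0) => w; rewrite lerBlDr.
  apply: le_trans (gf _ (cons_pair (x' : measurableTypeR R, shift y w))) _.
  rewrite costn_cons/= /k [leRHS]addrAC [leLHS]addrA lerD2l.
  rewrite /costn le_eqVlt; apply/orP; left; apply/eqP; apply: eq_bigr => i _.
  by rewrite coord_mktuple; congr c; ring.
rewrite integral_power_probS; last 2 first.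
- exact: measurable_expRM.
- by move=> z; exact: expR_ge0.
have -> : \int[power_prob mu n.+1]_x f x = \int[power_prob mu n]_y F y.
  rewrite /Rintegral integral_power_probS//; congr fine; apply: eq_integral => y _.
  rewrite -EFin_Rintegral//; apply: (bounded_integrable mu (M := r)) => // x.
  by have /andP[? ?] := f0r (cons_pair (x, y)); rewrite ger0_norm.
apply: le_trans (IH _ _ F_lip F_sc (lipn_measurable L0 G_lip) F0r G0r GF).
apply: ge0_le_integral_nomeas => y.
  by apply: integral_ge0 => x _; rewrite lee_fin expR_ge0.
rewrite -EFin_Rintegral ?lee_fin ?gh//.
apply: (bounded_integrable mu (M := expR (Lambda * r))).
  apply: (measurable_expRM (f := fun x => g (cons_pair (x, y)))).
  exact: cons_pair_fixed_measurable.
move=> x; rewrite ger0_norm ?expR_ge0// ler_expR ler_wpM2l//.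
by have /andP[] := g0r (cons_pair (x, y)).
Qed.

End tensorization.

(** * The conjugate and the growth function *)

Section conjugate_theory.
Context {R : realType} (H : R -> R).
Context (H_ge0 : forall x, 0 <= H x) (H0 : H 0 = 0)
  (H_quad : forall x y, 0 < x -> x <= y -> H x / x ^+ 2 <= H y / y ^+ 2).

Lemma quad_scale s x : 0 <= s -> s <= 1 -> 0 <= x -> H (s * x) <= s ^+ 2 * H x.
Proof.
rewrite le_eqVlt => /predU1P[<-|s0] s1; first by rewrite !mul0r H0 expr0n mul0r.
rewrite le_eqVlt => /predU1P[<-|x0]; first by rewrite mulr0 H0 mulr0.
have sx : 0 < s * x by rewrite mulr_gt0.
have := H_quad sx (_ : s * x <= x); rewrite ler_piMl// ?(ltW x0)// => /(_ isT).
rewrite ler_pdivrMr ?exprn_gt0// => /le_trans; apply.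
by rewrite le_eqVlt; apply/orP; left; apply/eqP; field; rewrite gt_eqF.
Qed.

Lemma quad_homo x y : 0 <= x -> x <= y -> H x <= H y.
Proof.
move=> x0; rewrite le_eqVlt => /predU1P[->//|xy].
have y0 : 0 < y by exact: le_lt_trans xy.
have s0 : 0 <= x / y by rewrite divr_ge0// ltW.
have s1 : x / y <= 1 by rewrite ler_pdivrMr// mul1r ltW.
have := quad_scale s0 s1 (ltW y0); rewrite divfK ?gt_eqF// => /le_trans; apply.
by rewrite ler_piMl// expr_le1.
Qed.

Section superquadratic.
Context (H1_gt0 : 0 < H 1).

Definition cost (u : R) : R := fine (conjugate H u).

(** A radius beyond which the supremum defining [conjugate H u] gains nothing: [H x >= H 1 * x ^+ 2]
    for [x >= 1], so [x * |u| - H x] is nonpositive past [X u]. *)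
Let X (u : R) := 1 + `|u| / H 1.

Let X_large u x : X u <= x -> x * `|u| - H x <= 0.
Proof.
move=> Xx; have uH : 0 <= `|u| / H 1 by rewrite divr_ge0.
have x1 : 1 <= x by apply: le_trans Xx; rewrite /X; lra.
have := H_quad ltr01 x1; rewrite expr1n divr1 ler_pdivlMr; last first.
  by rewrite exprn_gt0//; lra.
have ux : `|u| <= x * H 1.
  by rewrite -ler_pdivrMr//; apply: le_trans Xx; rewrite /X; lra.
have : x * `|u| <= x * (x * H 1) by rewrite ler_wpM2l//; lra.
lra.
Qed.

Let bounded u x : 0 <= x -> x * `|u| - H x <= X u * `|u|.
Proof.
move=> x0; have X0 : 0 <= X u by rewrite addr_ge0// divr_ge0.
have [xX|/ltW /X_large H'] := leP x (X u).
  by rewrite lerBlDr (le_trans (ler_wpM2r _ xX))// lerDl.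
by rewrite (le_trans H')// mulr_ge0.
Qed.

Lemma conjugateE u : conjugate H u = (cost u)%:E.
Proof.
rewrite /cost fineK// ge0_fin_numE.
  apply: (@le_lt_trans _ _ (X u * `|u|)%:E); last exact: ltry.
  by apply: ge_ereal_sup => _ [x /= x0 <-]; rewrite lee_fin; exact: bounded.
by apply: ereal_sup_ubound; exists 0 => //=; rewrite mul0r H0 subrr.
Qed.

Lemma cost_ge u x : 0 <= x -> x * `|u| - H x <= cost u.
Proof.
by move=> x0; rewrite -lee_fin -conjugateE; apply: ereal_sup_ubound; exists x.
Qed.

Lemma cost_le u m : (forall x, 0 <= x -> x * `|u| - H x <= m) -> cost u <= m.
Proof.
move=> Hm; rewrite -lee_fin -conjugateE.
by apply: ge_ereal_sup => _ [x /= x0 <-]; rewrite lee_fin; exact: Hm.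
Qed.

Lemma cost_ge0 u : 0 <= cost u.
Proof. by have := cost_ge u (lexx 0); rewrite mul0r H0 subrr. Qed.

Lemma cost0 : cost 0 = 0.
Proof.
apply/eqP; rewrite eq_le cost_ge0 andbT; apply: cost_le => x _.
by rewrite normr0 mulr0 sub0r oppr_le0.
Qed.

Lemma cost_even u : cost (- u) = cost u.
Proof. by rewrite /cost /conjugate normrN. Qed.

Lemma cost_convex a b t : 0 <= t <= 1 ->
  cost (t * a + (1 - t) * b) <= t * cost a + (1 - t) * cost b.
Proof.
move=> /andP[t0 t1]; apply: cost_le => x x0.
have t1' : 0 <= 1 - t by rewrite subr_ge0.
have := ler_wpM2l t0 (cost_ge a x0); have := ler_wpM2l t1' (cost_ge b x0).
have : x * `|t * a + (1 - t) * b| <= x * (t * `|a| + (1 - t) * `|b|).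
  rewrite ler_wpM2l// (le_trans (ler_normD _ _))// !normrM.
  by rewrite (ger0_norm t0) (ger0_norm t1').
lra.
Qed.

Lemma cost_legendre L u : 0 <= L -> L * `|u| - cost u <= H L.
Proof. by move=> /(cost_ge u); lra. Qed.

(* The chord slope of [H] at [s / 2] is an approximate maximizer: it avoids
   biconjugation at the price of halving the argument of [H]. *)
Lemma cost_half s : 0 <= s -> exists2 u, 0 <= u & H (s / 2) <= s * u - cost u.
Proof.
rewrite le_eqVlt => /predU1P[<-|s0].
  by exists 0 => //; rewrite mul0r H0 cost0 mul0r subrr.
have s2 : 0 < s / 2 by rewrite divr_gt0.
pose u := H (s / 2) / (s / 2).
have u0 : 0 <= u by rewrite divr_ge0// ltW.
have uE : s / 2 * u = H (s / 2) by rewrite /u mulrC divfK// gt_eqF.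
exists u => //.
suff : cost u <= H (s / 2) by lra.
apply: cost_le => x x0; rewrite (ger0_norm u0) -uE.
have [xs|sx] := leP x (s / 2).
  by rewrite lerBlDr (le_trans (ler_wpM2r u0 xs))// lerDl.
have x'0 : 0 < x by exact: lt_trans sx.
have := H_quad s2 (ltW sx); rewrite ler_pdivlMr ?exprn_gt0// => Hx.
apply: (@le_trans _ _ 0); last by rewrite mulr_ge0// ltW.
rewrite subr_le0; apply: le_trans Hx.
have -> : H (s / 2) / (s / 2) ^+ 2 * x ^+ 2 = x * u * (x / (s / 2)).
  by rewrite /u; field; rewrite gt_eqF.
apply: ler_peMr; first exact: mulr_ge0.
by rewrite ler_pdivlMr// mul1r ltW.
Qed.

(** Testing [x = 1] gives [|u| <= cost u + H 1], so a sublevel set is bounded. There the relevant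
    maximizers [x] stay below [K], and they are the slopes of the cost. *)
Lemma cost_loclip r : exists2 K, 0 <= K & forall u v, cost u <= r ->
  `|u - v| <= 1 -> cost v <= cost u + K * `|u - v|.
Proof.
pose K := 1 + (`|r| + H 1 + 1) / H 1.
have K0 : 0 <= K by rewrite addr_ge0// divr_ge0// !addr_ge0.
exists K => // u v ur uv.
have uu : `|u| <= `|r| + H 1.
  have := cost_ge u ler01; rewrite mul1r; have := ler_norm r; lra.
have vv : `|v| <= `|r| + H 1 + 1.
  have := ler_normB u (u - v); rewrite (_ : u - (u - v) = v); [lra|ring].
have XK : X v <= K by rewrite /X /K lerD2l ler_wpM2r// invr_ge0.
apply: cost_le => x x0; have Kuv : 0 <= K * `|u - v| by rewrite mulr_ge0.
have cu := cost_ge0 u.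
have [xX|/ltW /X_large] := leP x (X v); last by lra.
have xK := le_trans xX XK.
have : x * `|v| <= x * (`|u| + `|u - v|).
  rewrite ler_wpM2l//.
  have := ler_normB u (u - v); rewrite (_ : u - (u - v) = v)//; ring.
have := cost_ge u x0; have : x * `|u - v| <= K * `|u - v| by rewrite ler_wpM2r.
lra.
Qed.

End superquadratic.

Lemma omega_ge0 x : (0 <= omega H x)%E.
Proof.
apply: (@le_trans _ _ ((H (1 * x)%R)%:E / (H 1)%:E)%E).
  by rewrite mule_ge0 ?lee_fin// inve_ge0 lee_fin.
by apply: ereal_sup_ubound; exists 1 => //=.
Qed.

Lemma omega_le x w t : (omega H x <= w%:E)%E -> 0 < t -> H (t * x) <= w * H t.
Proof.
move=> Hw t0.
have : ((H (t * x)%R)%:E / (H t)%:E <= w%:E)%E.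
  by apply: le_trans Hw; apply: ereal_sup_ubound; exists t.
(* If [H t = 0], the quotient is 0 or [+oo]; finiteness of [omega] excludes the latter, so
   [H (t * x) = 0]. *)
have := H_ge0 t; rewrite le_eqVlt => /predU1P[<-|Ht].
  rewrite inve0 mulr0; have := H_ge0 (t * x); rewrite le_eqVlt => /predU1P[<-//|Htx].
  by rewrite gt0_muley ?lte_fin// leye_eq.
by rewrite inver gt_eqF// -EFinM lee_fin ler_pdivrMr.
Qed.

(** Doubling propagates the zero at 1 to all powers of 2, and monotonicity to the half-line; every
    quotient is then [0 / 0 = 0]. *)
Lemma omega2_eq0 W : omega H 2 = W%:E -> H 1 = 0 -> W = 0.
Proof.
move=> w2 H10.
have W0 : 0 <= W by have := omega_ge0 2; rewrite w2.
have pow n : H (2 ^+ n) = 0.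
  elim: n => [|n IH]; first by rewrite expr0.
  apply/eqP; rewrite eq_le H_ge0 andbT exprSr.
  rewrite (le_trans (omega_le (w := W) _ _)) ?w2 ?IH ?mulr0//.
have Hz x : 0 <= x -> H x = 0.
  move=> x0; apply/eqP; rewrite eq_le H_ge0 andbT -(pow (Num.bound x)).
  apply: quad_homo => //; apply: (le_trans (ltW (archi_boundP x0))).
  by rewrite -natrX ler_nat ltnW// ltn_expl.
apply/eqP; rewrite eq_le W0 andbT -lee_fin -w2.
apply: ge_ereal_sup => _ [t /= t0 <-].
by rewrite Hz ?mul0e// mulr_ge0// ltW.
Qed.

Lemma rate_le W kappa k : omega H 2 = W%:E -> 0 < W -> 0 < kappa -> 0 <= k ->
  (forall x w, (omega H x <= w%:E)%E -> W * kappa * w < x -> x <= k) ->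
  (rate H kappa <= k%:E)%E.
Proof.
move=> w2 W0 kappa0 k0 Hk; rewrite /rate w2 /=.
have Wk : 0 < W * kappa by rewrite mulr_gt0.
rewrite -EFinM.
apply: (@le_trans _ _ ((W * kappa)%:E * (k / (W * kappa))%:E)%E); last first.
  by rewrite -EFinM lee_fin mulrC divfK// gt_eqF.
apply: lee_wpmul2l; first by rewrite lee_fin ltW.
apply: ge_ereal_sup => _ [x /= x0 <-].
have := omega_ge0 x; case wE : (omega H x) => [w| |]// w0; last by rewrite /= leNye.
rewrite lee_fin in w0; rewrite -EFinB lee_fin.
have kW : 0 <= k / (W * kappa) by rewrite divr_ge0// ltW.
(* An [x] that is not admissible contributes at most 0 to the supremum. *)
have [xw|wx] := leP x (W * kappa * w).
  have : x / (W * kappa) <= w by rewrite ler_pdivrMr// mulrC.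
  by lra.
have : x <= k by apply: (Hk x w) => //; rewrite wE.
by rewrite -(@ler_pM2r _ (W * kappa)^-1) ?invr_gt0//; lra.
Qed.

End conjugate_theory.

(** * Truncated distance to a set *)

Section truncated_distance.
Context {R : realType} (n : nat).

Local Notation Rn := (n.-tuple (measurableTypeR R)).

Context (A : set Rn) (a0 : Rn) (r rho : R).
Context (Aa0 : A a0) (r_gt0 : 0 < r) (rho_gt0 : 0 < rho).

(** The parabola [M * sqd x a] reaches the height [r] at distance [rho] from [a]. Truncated at [r]
    and minimized over [A], such parabolas approximate [r] times the indicator of the complement of
    [A], with one semiconcavity constant for all [a]. *)
Let M := r / rho ^+ 2.
Let sqd (x a : Rn) := \sum_(i < n) (coord x i - coord a i) ^+ 2.
Let k (a : {a | A a}) (x : Rn) := Num.min r (M * sqd x (sval a)).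

Definition truncated_sqdist (x : Rn) := inf (range (k ^~ x)).

Let A0 : {a | A a} := exist _ a0 Aa0.

Let M_gt0 : 0 < M. Proof. by rewrite divr_gt0// exprn_gt0. Qed.

Let sqd_ge0 x a : 0 <= sqd x a.
Proof. by apply: sumr_ge0 => i _; exact: sqr_ge0. Qed.

Let k_ge0 x a : 0 <= k a x.
Proof. by rewrite le_min (ltW r_gt0) mulr_ge0// ltW. Qed.

Let k_lt_near x a : k a x < r -> forall i, `|coord x i - coord (sval a) i| <= rho.
Proof.
rewrite gt_min ltxx/= => H i.
rewrite -ler_sqr ?nnegrE ?(ltW rho_gt0)// real_normK ?num_real//.
have H1 : (coord x i - coord (sval a) i) ^+ 2 <= sqd x (sval a).
  rewrite /sqd (bigD1 i)//= lerDl; apply: sumr_ge0 => j _; exact: sqr_ge0.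
apply: (le_trans H1); rewrite -(ler_pM2l M_gt0); apply: (le_trans (ltW H)).
by rewrite /M divfK// expf_neq0// gt_eqF.
Qed.

Lemma truncated_sqdist_bound x : 0 <= truncated_sqdist x <= r.
Proof.
apply/andP; split; first exact: (le_infr A0).
by apply: (le_trans (infr_le A0 (k_ge0 x))); rewrite ge_min lexx.
Qed.

Lemma truncated_sqdist_eq0 x : A x -> truncated_sqdist x = 0.
Proof.
move=> Ax; apply/eqP; rewrite eq_le; have /andP[-> _] := truncated_sqdist_bound x.
rewrite andbT; apply: (le_trans (infr_le (exist _ x Ax) (k_ge0 x))).
by rewrite ge_min /sqd big1 ?mulr0 ?lexx ?orbT// => i _; rewrite subrr expr0n.
Qed.


Lemma truncated_sqdist_ge x m : m <= r ->
  (forall a, A a -> (forall i, `|coord x i - coord a i| <= rho) -> m <= 0) ->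
  m <= truncated_sqdist x.
Proof.
move=> mr Hm; apply: (le_infr A0) => a.
have [rk|kr] := leP r (k a x); first exact: le_trans rk.
by apply: (le_trans (Hm _ (svalP a) (k_lt_near kr))); exact: k_ge0.
Qed.

(** Below the truncation each coordinate of [y] is within [rho] of [a]. Moving it by [d] with
    [|d| <= rho] raises the square by at most [2 * rho * |d| + rho * |d|], and
    [M * 3 * rho = 3 * (r / rho)]. *)
Lemma truncated_sqdist_lip : lipn (3 * (r / rho)) truncated_sqdist.
Proof.
have H x y : truncated_sqdist x <= truncated_sqdist y
    + 3 * (r / rho) * \sum_(i < n) `|coord x i - coord y i|.
  apply: (infr_leD A0 (k_ge0 x)) => a; exists a.
  set D := \sum_(i < n) _.
  have D0 : 0 <= D by apply: sumr_ge0.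
  have rr : 0 <= r / rho by rewrite ltW// divr_gt0.
  have LD : 0 <= 3 * (r / rho) * D by rewrite mulr_ge0// mulr_ge0.
  have kr : k a x <= r by rewrite ge_min lexx.
  have [rk|ka] := leP r (k a y); first by apply: (le_trans kr); lra.
  have near := k_lt_near ka.
  (* A displacement larger than [rho] in some coordinate makes the right-hand side exceed the
     maximal height [r]. *)
  have [[i /negP]|Dsmall] := pselect (exists i, ~ (`|coord x i - coord y i| <= rho)).
    rewrite -ltNge => Hi; apply: (le_trans kr).
    have iD : `|coord x i - coord y i| <= D.
      by rewrite /D (bigD1 i)//= lerDl; apply: sumr_ge0.
    have : r <= r / rho * D.
      rewrite -mulrA ler_peMr ?(ltW r_gt0)// mulrC ler_pdivlMr// mul1r.
      by rewrite (le_trans (ltW Hi)).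
    by have := k_ge0 y a; lra.
  have {Dsmall} xy i : `|coord x i - coord y i| <= rho.
    by apply: contrapT => Hi; apply: Dsmall; exists i.
  have : M * sqd x (sval a) <= M * sqd y (sval a) + 3 * (r / rho) * D.
    have -> : 3 * (r / rho) * D = M * (3 * rho * D).
      by rewrite /M; field; rewrite gt_eqF.
    rewrite -mulrDr ler_wpM2l ?(ltW M_gt0)// /sqd /D mulr_sumr -big_split/=.
    apply: ler_sum => i _.
    set d := coord x i - coord y i in xy *; set e := coord y i - coord (sval a) i.
    have -> : coord x i - coord (sval a) i = e + d by rewrite /e /d; ring.
    have ed : 2 * (e * d) <= 2 * (rho * `|d|).
      rewrite ler_wpM2l// (le_trans (ler_norm _))// normrM ler_wpM2r//; exact: near.
    have dd : d ^+ 2 <= rho * `|d|.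
      by rewrite -real_normK ?num_real// expr2 ler_wpM2r//; exact: xy.
    by rewrite sqrrD mulr2n; lra.
  move=> Hsq; rewrite ge_min; apply/orP; right.
  by move: ka; rewrite /k gt_min ltxx/= => ka; rewrite min_r// ltW.
move=> x y; rewrite ler_norml lerBlDl H andbT lerBrDl -lerBrDr opprK.
by under eq_bigr do rewrite distrC; exact: H.
Qed.

(** For the squared distance to a fixed [a], semiconcavity with constant 1 is an identity;
    truncation from above and infima preserve the inequality. *)
Lemma truncated_sqdist_semiconcave : semiconcaven M truncated_sqdist.
Proof.
move=> x y t /[dup] t01 /andP[t0 t1].
apply: (infr_conv A0 t01 (k_ge0 x) (k_ge0 y)) => a; exists a, a.
have t1' : 0 <= 1 - t by rewrite subr_ge0.
set D := \sum_(i < n) _.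
have D0 : 0 <= M * (t * (1 - t) * D).
  rewrite mulr_ge0 ?(ltW M_gt0)// mulr_ge0//; first exact: mulr_ge0.
  by apply: sumr_ge0 => i _; exact: sqr_ge0.
have kx : k a x <= r by rewrite ge_min lexx.
have ky : k a y <= r by rewrite ge_min lexx.
have [rk|] := leP r (k a (segment t x y)).
  by have := ler_wpM2l t0 kx; have := ler_wpM2l t1' ky; lra.
rewrite {1}/k gt_min ltxx/= => ka; rewrite [k a (segment _ _ _)]min_r ?(ltW ka)//.
have : t * k a x <= t * (M * sqd x (sval a)) by rewrite ler_wpM2l// ge_min lexx orbT.
have : (1 - t) * k a y <= (1 - t) * (M * sqd y (sval a)).
  by rewrite ler_wpM2l// ge_min lexx orbT.
suff : sqd (segment t x y) (sval a) + t * (1 - t) * D =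
    t * sqd x (sval a) + (1 - t) * sqd y (sval a).
  by move=> /(congr1 ( *%R M)); lra.
rewrite /D /sqd !mulr_sumr -!big_split/=; apply: eq_bigr => i _.
by rewrite coord_mktuple; ring.
Qed.

End truncated_distance.

(** * Concentration *)

Section concentration.
Context {R : realType} (mu : probability (measurableTypeR R) R)
  (H : R -> R) (kappa : R).
Context (H_ge0 : forall x, 0 <= H x) (H0 : H 0 = 0)
  (H_quad : forall x y, 0 < x -> x <= y -> H x / x ^+ 2 <= H y / y ^+ 2)
  (H1_gt0 : 0 < H 1) (kappa_gt0 : 0 < kappa)
  (lsi : modified_log_Sobolev mu H kappa).

Local Notation Rn n := (n.-tuple (measurableTypeR R)).
Local Notation c := (cost H).

Let cE := conjugateE H_ge0 H0 H_quad H1_gt0.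
Let c_ge0 := cost_ge0 H_ge0 H0 H_quad H1_gt0.
Let c0 := cost0 H_ge0 H0 H_quad H1_gt0.

Lemma Minkowski_conjugate_ballP n (A : set (Rn n)) r x :
  Minkowski_sum A (conjugate_ball H r) x <->
  exists2 a, A a & costn c x a < r.
Proof.
have ballE b : conjugate_ball H r b = (\sum_(i < n) c (coord b i) < r) :> Prop.
  rewrite /conjugate_ball/=; under eq_bigr do rewrite cE.
  by rewrite sumEFin lte_fin.
split=> [[a Aa [b]]|[a Aa xa]].
  rewrite ballE => Bb <-; exists a => //; apply: le_lt_trans Bb.
  rewrite le_eqVlt; apply/orP; left; apply/eqP; apply: eq_bigr => i _.
  by rewrite {1}/coord tnth_mktuple; congr (c _); rewrite /coord; ring.
exists a => //; exists (mktuple_R (fun i => coord x i - coord a i)).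
  by rewrite ballE; under eq_bigr do rewrite coord_mktuple.
apply: eq_from_tnth => i; rewrite tnth_mktuple.
by rewrite -[tnth (mktuple_R _) i]/(coord _ i) coord_mktuple /coord; ring.
Qed.

(** The sum is open for every [A], because the cost is locally Lipschitz on its sublevel sets. *)
Lemma Minkowski_conjugate_ball_measurable n (A : set (Rn n)) r :
  measurable (Minkowski_sum A (conjugate_ball H r)).
Proof.
have [K K0 cK] := cost_loclip H_ge0 H0 H_quad H1_gt0 r.
apply: open_measurable => x /Minkowski_conjugate_ballP[a Aa xa].
pose D := n%:R * K + 1.
have D0 : 0 < D by rewrite ltr_wpDl// mulr_ge0.
pose e := Num.min 1 ((r - costn c x a) / D).
have e0 : 0 < e by rewrite lt_min ltr01 divr_gt0// subr_gt0.
exists e => // y xy; apply/Minkowski_conjugate_ballP; exists a => //.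
apply: (@le_lt_trans _ _ (costn c x a + n%:R * (K * e))).
  have -> : n%:R * (K * e) = \sum_(i < n) (K * e).
    by rewrite sumr_const card_ord mulr_natl.
  rewrite /costn -big_split/=; apply: ler_sum => i _.
  have xi : coord x i - coord a i - (coord y i - coord a i) = coord x i - coord y i.
    by ring.
  have := cK (coord x i - coord a i) (coord y i - coord a i); rewrite xi.
  move=> /(_ _ _)/le_trans; apply.
  - apply: le_trans (ltW xa); rewrite /costn (bigD1 i)//= lerDl.
    by apply: sumr_ge0 => j _; exact: c_ge0.
  - by rewrite (le_trans (ltW (xy i)))// ge_min lexx.
  - by rewrite lerD2l ler_wpM2l// ltW.
have : e * D <= r - costn c x a by rewrite -ler_pdivlMr// ge_min lexx orbT.
by rewrite /D; lra.
Qed.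

Lemma infimum_convolution_line W w x r L C (f g : R -> R) :
  (omega H 2 <= W%:E)%E -> (omega H x <= w%:E)%E ->
  0 < W -> 0 < w -> W * kappa * w < x ->
  0 <= L -> 0 <= C -> lip L f -> semiconcave C f ->
  measurable_fun [set: measurableTypeR R] (g : measurableTypeR R -> R) ->
  (forall y, 0 <= f y <= r) -> (forall y, 0 <= g y <= r) ->
  (forall y z, g y <= f z + c (y - z)) ->
  \int[mu]_y expR (2 * x * g y) <= expR (2 * x * \int[mu]_y f y).
Proof.
move=> W2 wx W0 w0 xW L0 C0 fL fC mg f0r g0r gf.
have f0 y : 0 <= f y by have /andP[] := f0r y.
have fr y : f y <= r by have /andP[] := f0r y.
have Wkw : 0 < W * kappa * w by rewrite !mulr_gt0.
have x0 : 0 < x by exact: lt_trans xW.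
(* [alpha] and [T] solve [alpha * T = 2 * x], the desired exponent, together with
   [alpha * kappa * W * w = (2 * x) ^+ 2], which balances [H_scale]. Admissibility of [x] gives
   [T <= 1], so the infimum-convolution at time 1 lies below that at time [T]. *)
pose alpha := (2 * x) ^+ 2 / (W * kappa * w).
pose T := W * kappa * w / (2 * x).
have alpha0 : 0 < alpha by rewrite divr_gt0// exprn_gt0// mulr_gt0.
have T0 : 0 < T by rewrite divr_gt0// mulr_gt0.
have T1 : T <= 1 by rewrite ler_pdivrMr ?mulr_gt0//; lra.
have alphaT : alpha * T = 2 * x.
  by rewrite /alpha /T; field; rewrite !gt_eqF.
have H_scale s lambda : 0 <= s -> 0 <= lambda -> lambda <= alpha * T ->
    alpha * kappa * H (lambda / 2 * s) <= lambda ^+ 2 * H (s / 2).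
  rewrite alphaT le_eqVlt => /predU1P[<-|s0] l0 lx.
    by rewrite mulr0 mul0r H0 !mulr0.
  have l1 : lambda / (2 * x) <= 1 by rewrite ler_pdivrMr ?mulr_gt0// mul1r.
  have l1' : 0 <= lambda / (2 * x) by rewrite divr_ge0// mulr_ge0// ltW.
  (* Quadratic growth extracts [lambda ^+ 2], then [omega H x] removes the dilation by [x], and
     [omega H 2] passes from [s] to [s / 2]. *)
  have h1 : H (lambda / 2 * s) <= (lambda / (2 * x)) ^+ 2 * H (s * x).
    have -> : lambda / 2 * s = lambda / (2 * x) * (s * x).
      by field; rewrite gt_eqF.
    by apply: quad_scale => //; rewrite mulr_ge0// ltW.
  have h2 : H (s * x) <= w * H s by exact: omega_le.
  have h3 : H s <= W * H (s / 2).
    have -> : s = s / 2 * 2 by field.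
    rewrite [X in _ <= _ * H X](_ : _ = s / 2); last by field.
    by apply: omega_le => //; rewrite divr_gt0.
  have h4 : H (lambda / 2 * s) <= (lambda / (2 * x)) ^+ 2 * (w * (W * H (s / 2))).
    apply: (le_trans h1); rewrite ler_wpM2l ?sqr_ge0// (le_trans h2)//.
    by rewrite ler_wpM2l// ltW.
  have ak : 0 <= alpha * kappa by rewrite mulr_ge0// ltW.
  apply: (le_trans (ler_wpM2l ak h4)).
  rewrite le_eqVlt; apply/orP; left; apply/eqP; rewrite /alpha.
  by field; rewrite !gt_eqF.
have c_conv := cost_convex H_ge0 H0 H_quad H1_gt0.
have LB u : L * `|u| - c u <= H L by exact: cost_legendre.
have := @infimum_convolution_inequality R mu H c f kappa alpha T r L C (H L)
  c0 c_ge0 (cost_even H) c_conv f0 fr L0 C0 fL fC LB H_ge0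
  (cost_half H_ge0 H0 H_quad H1_gt0) kappa_gt0 alpha0 T0 H_scale lsi.
rewrite alphaT; apply: le_trans; have T0' := ltW T0.
have M y : 0 <= hopf_lax c f T y <= r.
  by rewrite hopf_lax_ge0// hopf_lax_le_bound.
have gQ y : g y <= hopf_lax c f T y.
  apply: (@le_trans _ _ (hopf_lax c f 1 y)); last exact: hopf_lax_nonincreasing.
  apply: (le_infr 0) => u; apply: (le_trans (gf y (y - 1 * u))).
  by rewrite !mul1r (_ : y - (y - u) = u)//; ring.
apply: le_Rintegral => //.
- apply: (bounded_integrable mu (M := expR (2 * x * r))).
    exact: measurable_expRM.
  move=> y; rewrite ger0_norm ?expR_ge0// ler_expR ler_wpM2l//; first lra.
  by have /andP[] := g0r y.
- apply: (bounded_integrable mu (M := expR (2 * x * r))).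
    apply: measurable_expRM; apply: continuous_measurable_fun.
    by apply: (lip_continuous L0); exact: hopf_lax_lip.
  move=> y; rewrite ger0_norm ?expR_ge0// ler_expR ler_wpM2l//; first lra.
  by have /andP[] := M y.
- by move=> y _; rewrite ler_expR ler_wpM2l//; lra.
Qed.

Lemma concentration W w x r n (A : set (Rn n)) :
  (omega H 2 <= W%:E)%E -> (omega H x <= w%:E)%E ->
  0 < W -> 0 < w -> W * kappa * w < x -> 0 < r -> measurable A ->
  ((2^-1)%:E <= power_prob mu n A)%E ->
  (1 - power_prob mu n (Minkowski_sum A (conjugate_ball H r))
     <= (expR (- (x * r)))%:E)%E.
Proof.
move=> W2 wx W0 w0 xW r0 mA A2.
set S := Minkowski_sum _ _.
have mS : measurable S by exact: Minkowski_conjugate_ball_measurable.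
set P := power_prob mu n in A2 *.
have x0 : 0 < x by apply: lt_trans xW; rewrite !mulr_gt0.
rewrite -probability_setC//.
have [a Aa] : A !=set0.
  apply/set0P/negP => /eqP A0; move: A2; rewrite A0 measure0.
  by rewrite lee_fin invr_le0 leNgt ltr0n.
have [K K0 cK] := cost_loclip H_ge0 H0 H_quad H1_gt0 r.
have key delta : 0 < delta -> delta < r ->
    (P (~` S) <= (expR (- (x * r) + 2 * x * delta))%:E)%E.
  move=> d0 dr.
  pose D := n%:R * K + 1.
  have D0 : 0 < D by rewrite ltr_wpDl// mulr_ge0.
  (* Moving every coordinate by at most [rho] raises the total cost by at most [delta]; the cap 1 is
     the range of [cost_loclip]. *)
  pose rho := Num.min 1 (delta / D).
  have rho0 : 0 < rho by rewrite lt_min ltr01 divr_gt0.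
  have rho1 : rho <= 1 by rewrite ge_min lexx.
  have rhoD : n%:R * (K * rho) <= delta.
    have : rho * D <= delta by rewrite -ler_pdivlMr// ge_min lexx orbT.
    by rewrite /D; lra.
  pose f := truncated_sqdist A r rho.
  pose g (y : Rn n) := (r - delta) * \1_(~` S) y.
  have fL := truncated_sqdist_lip Aa r0 rho0.
  have fC := truncated_sqdist_semiconcave Aa r0 rho0.
  have f0r := truncated_sqdist_bound Aa r0 rho0.
  have L0 : 0 <= 3 * (r / rho) by rewrite mulr_ge0// divr_ge0// ltW.
  have C0 : 0 <= r / rho ^+ 2 by rewrite ltW// divr_gt0// exprn_gt0.
  have mg : measurable_fun setT g.
    by apply: measurable_funM => //; apply: measurable_indic; exact: measurableC.
  have g0r y : 0 <= g y <= r.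
    by rewrite /g indicE; case: (_ \in _); rewrite ?mulr1 ?mulr0; lra.
  (* For [y] outside [S] and [z] within [rho] of some [b] in [A], the cost from [y] to [b] is at
     least [r], so the cost from [y] to [z] is at least [r - delta]. Away from [A], [f z] supplies
     the height. *)
  have gf y z : g y <= f z + costn c y z.
    have cyz : 0 <= costn c y z by apply: sumr_ge0 => i _; exact: c_ge0.
    have /andP[fz0 _] := f0r z.
    rewrite /g indicE; case: (boolP (y \in ~` S)); rewrite ?mulr1 ?mulr0; last first.
      by rewrite addr_ge0.
    rewrite in_setE => nSy; rewrite -lerBlDr.
    apply: (truncated_sqdist_ge Aa r0 rho0); first lra.
    move=> b Ab zb; rewrite leNgt; apply/negP => H2.
    apply: nSy; apply/Minkowski_conjugate_ballP; exists b => //.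
    apply: (@le_lt_trans _ _ (costn c y z + n%:R * (K * rho))); last lra.
    have -> : n%:R * (K * rho) = \sum_(i < n) (K * rho).
      by rewrite sumr_const card_ord mulr_natl.
    rewrite /costn -big_split/=; apply: ler_sum => i _.
    have yi : coord y i - coord z i - (coord y i - coord b i) = - (coord z i - coord b i).
      by ring.
    have := cK (coord y i - coord z i) (coord y i - coord b i); rewrite yi normrN.
    move=> /(_ _ _)/le_trans; apply.
    - apply: (@le_trans _ _ (costn c y z)); last lra.
      rewrite /costn (bigD1 i)//= lerDl.
      by apply: sumr_ge0 => j _; exact: c_ge0.
    - exact: le_trans (zb i) _.
    - by rewrite lerD2l ler_wpM2l// zb.
  have x2 : 0 <= 2 * x by rewrite mulr_ge0// ltW.
  have H1d := infimum_convolution_line W2 wx W0 w0 xW.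
  have main := @power_prob_infimum_convolution R mu (2 * x) r c x2 c0 c_ge0
    (fun L C f g L0 C0 fL fC mg f0 g0 gf => H1d r L C f g L0 C0 fL fC mg f0 g0 gf)
    n _ _ f g L0 C0 fL fC mg f0r g0r gf.
  have fint : \int[P]_y f y <= r / 2.
    have mf := lipn_measurable L0 fL.
    have if_ : P.-integrable setT (EFin \o f).
      apply: (bounded_integrable P (M := r)) => // y.
      by have /andP[? ?] := f0r y; rewrite ger0_norm.
    apply: (@le_trans _ _ (\int[P]_y (r * \1_(~` A) y))).
      apply: le_Rintegral => //.
        apply: (bounded_integrable P (M := r)).
          by apply: measurable_funM => //; apply: measurable_indic; exact: measurableC.
        move=> y; rewrite indicE; case: (_ \in _); rewrite ?mulr1 ?mulr0 ?normr0 ?gtr0_norm//.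
        exact: ltW.
      move=> y _; rewrite indicE; case: (boolP (y \in ~` A)); rewrite ?mulr1 ?mulr0.
        by move=> _; have /andP[] := f0r y.
      rewrite notin_setE/= => /contrapT Ay.
      by rewrite /f (truncated_sqdist_eq0 Aa).
    have mCA : measurable (~` A) by exact: measurableC.
    rewrite RintegralZl//; last first.
      apply: (bounded_integrable P (M := 1)); first exact: measurable_indic.
      by move=> y; rewrite indicE; case: (_ \in _); rewrite ?normr1 ?normr0.
    rewrite ler_wpM2l ?(ltW r0)// /Rintegral integral_indic// setIT.
    rewrite [X in fine X](_ : _ = (1 - P A)%E); last exact: probability_setC.
    have PA : P A \is a fin_num by exact: fin_num_measure.
    rewrite -(fineK PA) lee_fin in A2; rewrite -(fineK PA) -EFinB/=; lra.
  (* Markov's inequality for the exponential of [2 * x * g]. *)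
  have gint : ((expR (2 * x * (r - delta)))%:E * P (~` S) <=
      \int[P]_y (expR (2 * x * g y))%:E)%E.
    rewrite -integral_cst//; last exact: measurableC.
    rewrite integral_mkcond; apply: ge0_le_integral_nomeas => y; rewrite patchE.
      by case: ifPn => // _; rewrite lee_fin expR_ge0.
    case: ifPn => [yS|_]; rewrite lee_fin ?expR_ge0//.
    by rewrite ler_expR /g indicE yS mulr1.
  have := le_trans gint main.
  have PS : P (~` S) \is a fin_num by apply: fin_num_measure; exact: measurableC.
  rewrite -(fineK PS) -EFinM !lee_fin -ler_pdivlMl ?expR_gt0// => /le_trans; apply.
  rewrite -expRN -expRD ler_expR.
  by have := ler_wpM2l x2 fint; lra.
have PS : P (~` S) \is a fin_num by apply: fin_num_measure; exact: measurableC.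
move: key; rewrite -(fineK PS) lee_fin; set p := fine _ => key.
have p0 : 0 <= p by apply: fine_ge0; exact: measure_ge0.
move: p0; rewrite le_eqVlt => /predU1P[<-|p0]; first exact: expR_ge0.
rewrite -[p]lnK ?posrE// ler_expR; apply/ler_addgt0Pr => e e0.
pose delta := Num.min (r / 2) (e / (2 * x)).
have x2 : 0 < 2 * x by rewrite mulr_gt0.
have d0 : 0 < delta by rewrite lt_min !divr_gt0.
have dr : delta < r by rewrite gt_min; apply/orP; left; lra.
have de : 2 * x * delta <= e.
  by rewrite mulrC -ler_pdivlMr// ge_min lexx orbT.
have kd := key _ d0 dr; rewrite lee_fin in kd.
apply: (@le_trans _ _ (- (x * r) + 2 * x * delta)); last by rewrite lerD2l.
by rewrite -ler_expR lnK ?posrE.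
Qed.

End concentration.

Unset Implicit Arguments.

Theorem theorem29 (R : realType) (mu : probability (measurableTypeR R) R)
    (n : nat) (H : R -> R) (kappa : R) :
  mu `<< lebesgue_measure ->
  (0 < n)%N ->
  (forall x, 0 <= H x) ->
  (forall x, H (- x) = H x) ->
  convex_function [set: R^o] H ->
  H 0 = 0 ->
  (forall x y, 0 < x -> x <= y -> H x / x ^+ 2 <= H y / y ^+ 2) ->
  strictly_convex (conjugate H) ->
  0 < kappa ->
  modified_log_Sobolev mu H kappa ->
  forall A : set (n.-tuple (measurableTypeR R)), measurable A ->
  ((2^-1)%:E <= power_prob mu n A)%E ->
  forall r : R, 0 <= r ->
  (1 - power_prob mu n (Minkowski_sum A (conjugate_ball H r))
     <= expeR (- (rate H kappa * r%:E)))%E.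
Proof.
move=> _ _ H_ge0 _ _ H0 H_quad _ kappa0 lsi A mA A2 r r0.
set S := Minkowski_sum _ _; set P := power_prob mu n in A2 *.
have trivial : (1 - P S <= 1)%E by rewrite geeDl// oppe_le0.
case w2E : (omega H 2) => [W| |]; last 2 first.
- by rewrite /rate w2E eqxx mul0e oppe0 expeR0.
- by have := omega_ge0 H_ge0 2; rewrite w2E.
have W0 : 0 <= W by have := omega_ge0 H_ge0 2; rewrite w2E.
have [W00|Wn0] := eqVneq W 0.
  by rewrite /rate w2E W00/= !mul0e oppe0 expeR0.
have {W0 Wn0} W0 : 0 < W by rewrite lt0r Wn0.
(* A finite nonzero [omega H 2] excludes [H 1 = 0]; positivity of [H 1] makes the conjugate
   finite. *)
have H1 : 0 < H 1.
  rewrite lt0r H_ge0 andbT; apply/eqP => H10.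
  by have := omega2_eq0 H_ge0 H0 H_quad w2E H10; lra.
(* The rate may be [+oo]; with [+oo * 0 = 0] the bound at [r = 0] is 1. *)
move: r0; rewrite le_eqVlt => /predU1P[r0|r0].
  by rewrite -r0 mule0 oppe0 expeR0.
have mS : measurable S by exact: Minkowski_conjugate_ball_measurable.
have PS : P S \is a fin_num by exact: fin_num_measure.
have pE : (1 - P S)%E = (1 - fine (P S))%:E by rewrite -(fineK PS) -EFinB.
rewrite pE; set p := 1 - fine (P S) in pE *.
have p0 : 0 <= p.
  by rewrite subr_ge0 -lee_fin fineK//; exact: probability_le1.
have p1 : p <= 1 by rewrite -lee_fin -pE.
move: p0; rewrite le_eqVlt => /predU1P[<-|p0]; first exact: expeR_ge0.
(* Solving the bound for the rate reduces the claim to one inequality on each admissible [x], and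
   shows the rate finite when [p > 0]. *)
have rate_k : (rate H kappa <= (- ln p / r)%:E)%E.
  apply: (rate_le H_ge0 w2E W0 kappa0).
    by rewrite divr_ge0 ?oppr_ge0 ?ln_le0// ltW.
  move=> x w wx wWx.
  have w0 : 0 <= w by rewrite -lee_fin (le_trans (omega_ge0 H_ge0 x)).
  have Wk : 0 < W * kappa by rewrite mulr_gt0.
  have wx' : w < x / (W * kappa) by rewrite ltr_pdivlMr// mulrC.
  (* [w] may be 0, while [concentration] divides by it; this midpoint is positive, still bounds
     [omega H x], and keeps [x] admissible. *)
  pose w' := (w + x / (W * kappa)) / 2.
  have w'x : w' < x / (W * kappa) by rewrite /w'; lra.
  have := @concentration R mu H kappa H_ge0 H0 H_quad H1 kappa0 lsi W w' x r n A.
  rewrite w2E lexx => /(_ isT); rewrite (le_trans wx) ?lee_fin; last by rewrite /w'; lra.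
  move=> /(_ isT W0).
  have -> : 0 < w' by rewrite /w'; lra.
  have -> : W * kappa * w' < x by rewrite mulrC -ltr_pdivlMr.
  move=> /(_ isT isT r0 mA A2); rewrite -/S -/P pE lee_fin => px.
  rewrite ler_pdivlMr// -[x * r]opprK lerN2 -[- (x * r)]expRK ler_ln ?posrE//.
  exact: expR_gt0.
apply: (@le_trans _ _ (expeR (- ((- ln p / r)%:E * r%:E))%E)).
  by rewrite -EFinM divfK ?gt_eqF// -EFinN opprK /= lnK.
by rewrite lee_expeR leeN2 lee_wpmul2r// lee_fin ltW.
Qed.
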